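(* Let $p\ge 1$ be an integer and let $F$ be a polyharmonic ($p$-harmonic) mapping in the unit disk $\mathbb{D}$ of the form $$F(z)=a_{0}+\sum_{k=1}^{p}|z|^{2(k-1)}\big(h_{k}(z)+\overline{g_{k}(z)}\big)=a_{0}+\sum_{k=1}^{p}|z|^{2(k-1)}\sum_{n=1}^{\infty}\big(a_{n,k}z^{n}+\overline{b_{n,k}}\,\overline{z}^{n}\big),$$ where $h_k(z)=\sum_{n\ge1}a_{n,k}z^n$ and $g_k(z)=\sum_{n\ge 1}b_{n,k}z^n$ are analytic in $\mathbb{D}$. Suppose that for all $n\ge1$ and $k_1,k_2,k_3,k_4\in\{1,\dots,p\}$, all non-zero coefficients $a_{n,k_{1}},a_{n,k_{2}}$ and $b_{n,k_{3}},b_{n,k_{4}}$ satisfy $$\left|\arg \frac{a_{n,k_{1}}}{a_{n,k_{2}}}\right|\leq\frac{\pi}{2}\quad\text{and}\quad\left|\arg \frac{b_{n,k_{3}}}{b_{n,k_{4}}}\right|\leq\frac{\pi}{2}.$$ If $|F(z)|\leq M$ in $\mathbb{D}$ for some $M>1$ and $F(0)=|J_{F}(0)|-1=0$, then $F$ is univalent in the disk $\mathbb{D}_{r_{1}}$ and $F(\mathbb{D}_{r_{1}})$ contains a univalent disk $\mathbb{D}_{\rho_{1}}$, where $r_{1}=r_1(M,p)$ is the least positive root of the equation $$1-\sqrt{M^{4}-1}\left(\frac{2r-r^{2}}{(1-r)^{2}}+\sum_{k=1}^{p-1}\frac{r^{2k}}{(1-r)^{2}} +2 \sum_{k=1}^{p-1}\frac{kr^{2k}}{1-r}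 \right)=0,$$ and $$\rho_{1}=\lambda_{0}(M)r_{1}\left(1-\sqrt{M^{4}-1}\,\frac{r_{1}}{1-r_{1}}-\sqrt{M^{4}-1}\sum_{k=1}^{p-1}\frac{2r_{1}^{2k}}{1-r_{1}}\right),\qquad \lambda_{0}(M)=\frac{\sqrt{2}}{\sqrt{M^{2}-1}+\sqrt{M^{2}+1}}.$$ In particular, if $|F(z)|\leq 1$ for all $z\in \mathbb{D}$ and $F(0)=|J_{F}(0)|-1=0$, then $F$ is univalent and maps $\mathbb{D}$ onto $\mathbb{D}$.
   Context: $\mathbb{D}_r=\{z\in\mathbb{C}:|z|<r\}$ and $\mathbb{D}=\mathbb{D}_1$. A $2p$ times continuously differentiable complex-valued mapping $F$ in a domain is polyharmonic (or $p$-harmonic), $p\ge1$, if $\Delta^pF=0$, where $\Delta=4\,\partial^2/\partial z\partial\overline z$ is the Laplacian and $\Delta^pF=\Delta(\Delta^{p-1}F)$. The argument $\arg$ is the principal value in $(-\pi,\pi]$. The Jacobian is $J_F(z)=|F_z(z)|^2-|F_{\overline z}(z)|^2$. Univalent means injective. The image $F(\mathbb{D}_{r})$ contains a univalent disk $\mathbb{D}_{\rho}$ if $F$ maps some subdomain of $\mathbb{D}_r$ injectively onto $\mathbb{D}_\rho$. Empty sums are $0$. *)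

(* Defs.v *)
From Stdlib Require Export Reals.
From Stdlib Require Import Lra Lia.
From Coquelicot Require Export Coquelicot.
Open Scope R_scope.

Definition disk (r : R) : C -> Prop := fun z => Cmod z < r.

(* For an open set, connectedness may be tested with open subsets of the plane. *)
Definition domain (U : C -> Prop) : Prop :=
  open U /\ (exists z, U z) /\
  (forall A B : C -> Prop, open A -> open B ->
     (forall z, U z <-> A z \/ B z) -> (forall z, ~ (A z /\ B z)) ->
     (forall z, ~ A z) \/ (forall z, ~ B z)).

(* Principal value, in (-PI, PI]; the value at 0 is irrelevant. *)
Definition Arg (z : C) : R :=
  if Rle_dec 0 (Im z) then acos (Re z / Cmod z) else - acos (Re z / Cmod z).

Lemma Arg_spec (z : C) : z <> RtoC 0 ->
  - PI < Arg z <= PI /\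
  Re z = Cmod z * cos (Arg z) /\ Im z = Cmod z * sin (Arg z).
Proof.
intros Hz.
assert (Hm : 0 < Cmod z) by now apply Cmod_gt_0.
assert (Hq : Cmod z * Cmod z = Re z * Re z + Im z * Im z).
{ unfold Cmod, Re, Im; rewrite sqrt_sqrt; [ring | nra]. }
set (u := Re z / Cmod z).
assert (Hu : Re z = Cmod z * u) by (unfold u; field; lra).
set (v := Im z / Cmod z).
assert (Hv : Im z = Cmod z * v) by (unfold v; field; lra).
assert (Huv : u * u + v * v = 1).
{ apply Rmult_eq_reg_l with (Cmod z * Cmod z); [|nra].
  transitivity (Re z * Re z + Im z * Im z); [rewrite Hu, Hv; ring | lra]. }
assert (Hb : -1 <= u <= 1) by nra.
pose proof (acos_bound u) as Hac.
unfold Arg; fold u; destruct (Rle_dec 0 (Im z)) as [Hi|Hi].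
- split; [pose proof PI_RGT_0; lra|].
  rewrite cos_acos, sin_acos by easy; split; [easy|].
  rewrite Hv at 1; f_equal.
  replace (1 - u²) with (v * v) by (unfold Rsqr; lra).
  symmetry; apply sqrt_square; nra.
- assert (Hv0 : v < 0) by nra.
  assert (acos u < PI) by (apply acos_bound_lt; nra).
  split; [lra|].
  rewrite cos_neg, sin_neg, cos_acos, sin_acos by easy; split; [easy|].
  rewrite Hv at 1; f_equal.
  replace (1 - u²) with ((- v) * (- v)) by (unfold Rsqr; lra).
  rewrite sqrt_square; lra.
Qed.

Definition ex_partials (f : C -> C) (z : C) : Prop :=
  ex_derive (fun t : R => Re (f (t, Im z))) (Re z) /\
  ex_derive (fun t : R => Im (f (t, Im z))) (Re z) /\
  ex_derive (fun t : R => Re (f (Re z, t))) (Im z) /\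
  ex_derive (fun t : R => Im (f (Re z, t))) (Im z).

Definition dx (f : C -> C) (z : C) : C :=
  (Derive (fun t : R => Re (f (t, Im z))) (Re z),
   Derive (fun t : R => Im (f (t, Im z))) (Re z)).

Definition dy (f : C -> C) (z : C) : C :=
  (Derive (fun t : R => Re (f (Re z, t))) (Im z),
   Derive (fun t : R => Im (f (Re z, t))) (Im z)).

(* [n] times continuously differentiable, in the real sense, on the open set [U]. *)
Fixpoint Cn_on (n : nat) (U : C -> Prop) (f : C -> C) : Prop :=
  (forall z, U z -> continuous f z) /\
  match n with
  | O => True
  | S m => (forall z, U z -> ex_partials f z) /\
           Cn_on m U (dx f) /\ Cn_on m U (dy f)
  end.

Definition dz (f : C -> C) (z : C) : C := ((dx f z - Ci * dy f z) / 2)%C.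

Definition dzbar (f : C -> C) (z : C) : C := ((dx f z + Ci * dy f z) / 2)%C.

Definition laplacian (f : C -> C) (z : C) : C := (4 * dz (dzbar f) z)%C.

Definition jacobian (f : C -> C) (z : C) : R :=
  (Cmod (dz f z)) ^ 2 - (Cmod (dzbar f z)) ^ 2.

Definition polyharmonic (p : nat) (U : C -> Prop) (F : C -> C) : Prop :=
  Cn_on (2 * p) U F /\
  (forall z, U z -> Nat.iter p laplacian F z = RtoC 0).

Definition analytic_on (U : C -> Prop) (f : C -> C) : Prop :=
  forall z, U z -> @ex_derive C_AbsRing C_NormedModule f z.

(* [f z] is the sum of [c n * z ^ n] over [n >= 1]; the value [c 0] is not used. *)
Definition power_series_from1 (c : nat -> C) (f : C -> C) (z : C) : Prop :=
  @is_series C_AbsRing C_NormedModule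
    (fun n : nat => (c (S n) * z ^ (S n))%C) (f z).

Definition univalent_on (U : C -> Prop) (F : C -> C) : Prop :=
  forall z w, U z -> U w -> F z = F w -> z = w.

Definition maps_onto (U : C -> Prop) (F : C -> C) (V : C -> Prop) : Prop :=
  forall w, V w <-> exists z, U z /\ F z = w.

Definition contains_univalent_disk (F : C -> C) (r rho : R) : Prop :=
  exists U : C -> Prop,
    domain U /\ (forall z, U z -> disk r z) /\
    univalent_on U F /\ maps_onto U F (disk rho).

Definition lambda0 (M : R) : R :=
  sqrt 2 / (sqrt (M ^ 2 - 1) + sqrt (M ^ 2 + 1)).

Definition radius_fun (M : R) (p : nat) (r : R) : R :=
  1 - sqrt (M ^ 4 - 1) *
      ((2 * r - r ^ 2) / (1 - r) ^ 2
       + sum_n_m (fun k : nat => r ^ (2 * k) / (1 - r) ^ 2) 1 (p - 1)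
       + 2 * sum_n_m (fun k : nat => INR k * r ^ (2 * k) / (1 - r)) 1 (p - 1)).

(* The left-hand side is undefined at [r = 1]; the value Rocq gives it there
   must not count as a root. *)
Definition positive_root (M : R) (p : nat) (r : R) : Prop :=
  0 < r /\ r <> 1 /\ radius_fun M p r = 0.

Definition least_positive_root (M : R) (p : nat) (r : R) : Prop :=
  positive_root M p r /\ (forall s, positive_root M p s -> r <= s).

Definition rho_fun (M : R) (p : nat) (r : R) : R :=
  lambda0 M * r *
  (1 - sqrt (M ^ 4 - 1) * (r / (1 - r))
     - sqrt (M ^ 4 - 1) *
       sum_n_m (fun k : nat => 2 * r ^ (2 * k) / (1 - r)) 1 (p - 1)).

(* Main.v *)
From Stdlib Require Import Lra Lia ClassicalEpsilon.
Require Import Defs.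

(** Write [F] as a real-linear map [lin] plus a remainder, where
    [lin z = a z + conj (b z)] with [a], [b] the coefficients of [z] in [h 1]
    and [g 1].  The remainder is quadratically small at [0], so the Jacobian
    there is [|a|^2 - |b|^2] and the hypothesis says that it is [1] or [-1].
    Hence [lam = ||a| - |b||], the smallest stretching of [lin], is the inverse
    of the largest one [|a| + |b|].

    Everything rests on how small the other coefficients are compared with
    [lam].  On the circle [|z| = r] the factors [|z|^(2(k-1))] are constants,
    so [F] is an ordinary harmonic series there and [bessel] bounds the sum of
    the squares of its coefficients by [M^2].  The condition on the arguments
    makes the [a_(n,k)] with the same [n] pairwise at most at a right angle, so
    the square of the modulus of their weighted sum dominates the sum of the
    squares.  Letting [r] tend to [1] gives, for each further pair
    [(u, v) = (a_(n,k), b_(n,k))],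
    [|a|^2 + |b|^2 + |u|^2 + |v|^2 <= M^2] ([coefficient_square_bound]).
    Together with [lam (|a| + |b|) = 1] this yields
    [|u| + |v| <= sqrt (M^4 - 1) lam] and [lambda0 M <= lam].

    Summing geometric series, the remainder is Lipschitz on [|z| <= r] with
    constant [lam sqrt (M^4 - 1) (lip_sum q r)], where [lip_sum] is the bracket
    in the equation that defines [r1] and [q = p - 1].  As this bracket
    increases from [0], the constant is below [lam] for [r < r1]: there [F] is a perturbation of [lin]
    that still expands distances, hence injective, and [F z = w] is the fixed
    point equation of the contraction [z |-> lin^-1 (w - remainder z)].  It can be
    solved in the disk as long as [|w|] is at most [lam r] minus the bound of
    the remainder, which at [r1] is at least [rho1].  The local inverse being
    Lipschitz along segments from [0], the preimage of the disk is connected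
    ([linear_perturbation]).

    For [M = 1] the factor [sqrt (M^4 - 1)] vanishes, so does the remainder,
    and [F] is [z |-> a z] or [z |-> conj (b z)] with a coefficient of modulus
    one. *)

(** * Finite sums *)

(** Fixing the carriers of the two kinds of sums keeps [ring] and [lra]
    usable on their values. *)
Definition csum (u : nat -> C) (n : nat) : C := @sum_n C_AbelianMonoid u n.

Definition rsum (u : nat -> R) (n : nat) : R := @sum_n R_AbelianMonoid u n.

Lemma csum_0 u : csum u 0 = u O.
Proof. exact (sum_O u). Qed.

Lemma csum_S u n : csum u (S n) = (csum u n + u (S n))%C.
Proof. exact (sum_Sn u n). Qed.

Lemma rsum_0 u : rsum u 0 = u O.
Proof. exact (sum_O u). Qed.

Lemma rsum_S u n : rsum u (S n) = rsum u n + u (S n).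
Proof. exact (sum_Sn u n). Qed.

Lemma csum_ext u v n : (forall k, (k <= n)%nat -> u k = v k) -> csum u n = csum v n.
Proof.
induction n as [|n IH]; intros H; [rewrite !csum_0; auto|].
rewrite !csum_S, IH, H; auto.
Qed.

Lemma csum_plus u v n : csum (fun k => u k + v k)%C n = (csum u n + csum v n)%C.
Proof. exact (sum_n_plus u v n). Qed.

Lemma csum_scal c u n : csum (fun k => c * u k)%C n = (c * csum u n)%C.
Proof. exact (sum_n_mult_l (K := C_Ring) c u n). Qed.

Lemma csum_conj u n : csum (fun k => Cconj (u k)) n = Cconj (csum u n).
Proof.
induction n as [|n IH]; [now rewrite !csum_0|].
now rewrite !csum_S, Cplus_conj, IH.
Qed.

Lemma Re_csum u n : Re (csum u n) = rsum (fun k => Re (u k)) n.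
Proof.
induction n as [|n IH]; [now rewrite csum_0, rsum_0|].
now rewrite csum_S, rsum_S, <- IH.
Qed.

Lemma rsum_ext u v n : (forall k, (k <= n)%nat -> u k = v k) -> rsum u n = rsum v n.
Proof.
induction n as [|n IH]; intros H; [rewrite !rsum_0; auto|].
rewrite !rsum_S, IH, H; auto.
Qed.

Lemma rsum_plus u v n : rsum (fun k => u k + v k) n = rsum u n + rsum v n.
Proof. exact (sum_n_plus u v n). Qed.

Lemma rsum_scal c u n : rsum (fun k => c * u k) n = c * rsum u n.
Proof. exact (sum_n_mult_l (K := R_Ring) c u n). Qed.

Lemma rsum_const c n : rsum (fun _ => c) n = INR (S n) * c.
Proof. exact (sum_n_const n c). Qed.

Lemma rsum_le u v n : (forall k, (k <= n)%nat -> u k <= v k) -> rsum u n <= rsum v n.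
Proof.
induction n as [|n IH]; intros H; [rewrite !rsum_0; auto|].
rewrite !rsum_S; apply Rplus_le_compat; auto.
Qed.

Lemma rsum_mono u m n : (forall k, 0 <= u k) -> (m <= n)%nat -> rsum u m <= rsum u n.
Proof.
intros H; induction 1 as [|n Hn IH]; [lra|].
rewrite rsum_S; specialize (H (S n)); lra.
Qed.

Lemma rsum_ge_term u n k : (forall i, 0 <= u i) -> (k <= n)%nat -> u k <= rsum u n.
Proof.
intros H Hk; apply Rle_trans with (rsum u k); [|now apply rsum_mono].
destruct k as [|k]; [rewrite rsum_0; lra|]; rewrite rsum_S.
assert (rsum u 0 <= rsum u k) by (apply rsum_mono; auto; lia).
rewrite rsum_0 in *; specialize (H O); lra.
Qed.

Lemma rsum_ge_two_terms u n k : (forall i, 0 <= u i) -> (0 < k <= n)%nat ->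
  u O + u k <= rsum u n.
Proof.
intros H Hk; apply Rle_trans with (rsum u k); [|apply rsum_mono; auto; lia].
destruct k as [|k]; [lia|]; rewrite rsum_S.
assert (u O <= rsum u k) by (apply rsum_ge_term; auto; lia); lra.
Qed.

Lemma Cmod_csum_le u n : Cmod (csum u n) <= rsum (fun k => Cmod (u k)) n.
Proof.
induction n as [|n IH]; [rewrite csum_0, rsum_0; lra|].
rewrite csum_S, rsum_S.
eapply Rle_trans; [apply Cmod_triangle|]; lra.
Qed.

Lemma csum_geom x n : ((x - 1) * csum (fun j => x ^ j) n)%C = (x ^ S n - 1)%C.
Proof.
induction n as [|n IH]; [rewrite csum_0; simpl; ring|].
rewrite csum_S, Cmult_plus_distr_l, IH, !Cpow_S; ring.
Qed.

Lemma geom_sum_le r m : 0 <= r < 1 -> rsum (fun n => r ^ n) m <= / (1 - r).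
Proof.
intros Hr.
assert (E : rsum (fun n => r ^ n) m = (1 - r ^ S m) / (1 - r)).
{ induction m as [|m IH]; [rewrite rsum_0; simpl; field; lra|].
  rewrite rsum_S, IH; simpl; field; lra. }
rewrite E; unfold Rdiv; rewrite <- (Rmult_1_l (/ (1 - r))) at 2.
apply Rmult_le_compat_r; [apply Rlt_le, Rinv_0_lt_compat; lra|].
pose proof (pow_le r (S m) (proj1 Hr)); lra.
Qed.

Lemma deriv_geom_sum_le r m : 0 <= r < 1 ->
  rsum (fun n => INR (S n) * r ^ n) m <= / (1 - r) ^ 2.
Proof.
intros Hr.
assert (E : rsum (fun n => INR (S n) * r ^ n) m =
   (1 - r ^ S m * (1 + INR (S m) * (1 - r))) / (1 - r) ^ 2).
{ induction m as [|m IH]; [rewrite rsum_0; simpl; field; lra|].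
  rewrite rsum_S, IH, (S_INR (S m)); simpl pow; field; lra. }
rewrite E; unfold Rdiv; rewrite <- (Rmult_1_l (/ (1 - r) ^ 2)) at 2.
apply Rmult_le_compat_r; [apply Rlt_le, Rinv_0_lt_compat; nra|].
pose proof (pow_le r (S m) (proj1 Hr)); pose proof (pos_INR (S m)).
assert (0 <= r ^ S m * (1 + INR (S m) * (1 - r))) by (apply Rmult_le_pos; nra).
lra.
Qed.

Lemma sum1_0 (u : nat -> R) : sum_n_m u 1 0 = 0.
Proof. exact (sum_n_m_zero u 1 0 Nat.lt_0_1). Qed.

Lemma sum1_S (u : nat -> R) q : sum_n_m u 1 (S q) = sum_n_m u 1 q + u (S q).
Proof. apply (sum_n_Sm u 1 q); lia. Qed.

(** * Complex series *)

Notation cseries := (@is_series C_AbsRing C_NormedModule).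

Lemma Cmod_sub_sym z w : Cmod (z - w) = Cmod (w - z).
Proof. rewrite <- Cmod_opp; f_equal; ring. Qed.

Lemma Cmod_ball z w e : Cmod (w - z) < e -> ball (z : C_UniformSpace) e w.
Proof. intros H; now apply C_NormedModule_mixin_compat1. Qed.

(** Balls of the plane are squares here, whose half diagonal is [sqrt 2] times
    the radius. *)
Lemma ball_Cmod z w (e : posreal) :
  ball (z : C_UniformSpace) e w -> Cmod (w - z) < 2 * e.
Proof.
intros H; eapply Rlt_trans; [exact (C_NormedModule_mixin_compat2 z w e H)|].
destruct e as [e He]; simpl.
assert (sqrt 2 < 2); [|nra].
rewrite <- (sqrt_square 2) at 2 by lra; apply sqrt_lt_1; lra.
Qed.

Lemma cseries_iff u l : cseries u l <->
  forall eps : R, 0 < eps -> exists N, forall n, (N <= n)%nat ->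
    Cmod (csum u n - l) < eps.
Proof.
unfold is_series; rewrite (filterlim_locally (U := C_UniformSpace)).
split.
- intros H eps He.
  assert (He2 : 0 < eps / 2) by lra.
  destruct (H (mkposreal _ He2)) as [N HN].
  exists N; intros n Hn.
  specialize (HN n Hn); apply ball_Cmod in HN; simpl in HN.
  eapply Rlt_le_trans; [exact HN|]; lra.
- intros H eps; unfold csum in H.
  destruct (H eps (cond_pos eps)) as [N HN].
  exists N; intros n Hn; apply Cmod_ball, HN, Hn.
Qed.

Lemma cseries_plus u v l m : cseries u l -> cseries v m ->
  cseries (fun n => (u n + v n)%C) (l + m)%C.
Proof. exact (is_series_plus u v l m). Qed.

Lemma cseries_scal c u l : cseries u l -> cseries (fun n => (c * u n)%C) (c * l)%C.
Proof. exact (is_series_scal c u l). Qed.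

Lemma cseries_ext (u v : nat -> C) l : (forall n, u n = v n) ->
  cseries u l -> cseries v l.
Proof. exact (is_series_ext u v l). Qed.

Lemma cseries_minus u v l m : cseries u l -> cseries v m ->
  cseries (fun n => (u n - v n)%C) (l - m)%C.
Proof.
intros Hu Hv; replace (l - m)%C with (l + (-1) * m)%C by ring.
apply (cseries_ext (fun n => (u n + (-1) * v n)%C)).
- intros n; ring.
- now apply cseries_plus, cseries_scal.
Qed.

Lemma cseries_conj u l : cseries u l -> cseries (fun n => Cconj (u n)) (Cconj l).
Proof.
rewrite !cseries_iff; intros H eps He.
destruct (H eps He) as [N HN]; exists N; intros n Hn.
rewrite csum_conj, <- Cminus_conj, Cmod_conj; auto.
Qed.

(** A closed ball that contains a tail of the partial sums contains the sum. *)
Lemma Cmod_cseries_le u l x B m : cseries u l ->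
  (forall n, (m <= n)%nat -> Cmod (csum u n - x) <= B) -> Cmod (l - x) <= B.
Proof.
rewrite cseries_iff; intros H HB.
apply Rle_plus_epsilon; intros eps He.
destruct (H eps He) as [N HN].
specialize (HN (Nat.max N m) (Nat.le_max_l _ _)).
specialize (HB (Nat.max N m) (Nat.le_max_r _ _)).
replace (l - x)%C with ((csum u (Nat.max N m) - x)
  + - (csum u (Nat.max N m) - l))%C by ring.
eapply Rle_trans; [apply Cmod_triangle|].
rewrite Cmod_opp; lra.
Qed.

Lemma Cmod_cseries_abs u l B : cseries u l ->
  (forall n, rsum (fun k => Cmod (u k)) n <= B) -> Cmod l <= B.
Proof.
intros H HB; replace l with (l - RtoC 0)%C by ring.
apply (Cmod_cseries_le u l _ B 0 H); intros n _.
replace (csum u n - RtoC 0)%C with (csum u n) by ring.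
eapply Rle_trans; [apply Cmod_csum_le | apply HB].
Qed.

(** * Harmonic power series *)

(** By telescoping, [z^(n+1) - w^(n+1) = z (z^n - w^n) + (z - w) w^n]. *)
Lemma Cmod_pow_sub_le z w r n : Cmod z <= r -> Cmod w <= r ->
  Cmod (z ^ n - w ^ n) <= INR n * r ^ (n - 1) * Cmod (z - w).
Proof.
intros Hz Hw; assert (Hr : 0 <= r) by (pose proof (Cmod_ge_0 z); lra).
destruct n as [|n].
{ simpl; replace (RtoC 1 - RtoC 1)%C with (RtoC 0) by ring; rewrite Cmod_0; lra. }
replace (S n - 1)%nat with n by lia.
induction n as [|n IH].
{ rewrite !Cpow_1_r; simpl; lra. }
rewrite (Cpow_S z), (Cpow_S w).
replace (z * z ^ S n - w * w ^ S n)%C with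
  (z * (z ^ S n - w ^ S n) + (z - w) * w ^ S n)%C by ring.
eapply Rle_trans; [apply Cmod_triangle|].
rewrite !Cmod_mult, (Cmod_pow w).
assert (Cmod w ^ S n <= r ^ S n) by (apply pow_incr; split; [apply Cmod_ge_0|easy]).
assert (Cmod z * Cmod (z ^ S n - w ^ S n)
   <= r * (INR (S n) * r ^ n * Cmod (z - w))).
{ apply Rmult_le_compat; auto using Cmod_ge_0. }
pose proof (Cmod_ge_0 (z - w)).
rewrite (S_INR (S n)).
replace ((INR (S n) + 1) * r ^ S n * Cmod (z - w)) with
  (r * (INR (S n) * r ^ n * Cmod (z - w)) + Cmod (z - w) * r ^ S n) by (simpl; ring).
apply Rplus_le_compat; [easy|].
apply Rmult_le_compat_l; easy.
Qed.

Definition harm (h g : C -> C) (z : C) : C := (h z + Cconj (g z))%C.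

Definition trig_term (A B : nat -> C) (n : nat) (z : C) : C :=
  (A n * z ^ n + Cconj (B n * z ^ n))%C.

Definition has_series (al be : nat -> C) (h g : C -> C) : Prop :=
  forall z, disk 1 z ->
    power_series_from1 al h z /\ power_series_from1 be g z.

Lemma harm_cseries al be h g z : has_series al be h g -> disk 1 z ->
  cseries (fun n => trig_term al be (S n) z) (harm h g z).
Proof.
intros H Hz; destruct (H z Hz) as [Hh Hg].
apply cseries_plus; [exact Hh|].
apply cseries_conj; exact Hg.
Qed.

(** The majorant [c] depends on the index so that a missing first
    coefficient can be exploited. *)
Lemma harm_bound al be h g c z r B : has_series al be h g ->
  (forall n, Cmod (al (S n)) + Cmod (be (S n)) <= c n) ->
  Cmod z <= r -> r < 1 ->
  (forall m, rsum (fun n => c n * r ^ S n) m <= B) ->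
  Cmod (harm h g z) <= B.
Proof.
intros H Hc Hz Hr HB.
assert (Hr0 : 0 <= r) by (pose proof (Cmod_ge_0 z); lra).
eapply Cmod_cseries_abs.
{ apply (harm_cseries al be h g z H); unfold disk; lra. }
intros m; unfold trig_term; eapply Rle_trans; [|apply (HB m)].
apply rsum_le; intros n _.
eapply Rle_trans; [apply Cmod_triangle|].
rewrite Cmod_conj, !Cmod_mult, !Cmod_pow, <- Rmult_plus_distr_r.
apply Rmult_le_compat; auto.
- pose proof (Cmod_ge_0 (al (S n))); pose proof (Cmod_ge_0 (be (S n))); lra.
- apply pow_le, Cmod_ge_0.
- apply pow_incr; split; [apply Cmod_ge_0 | easy].
Qed.

Lemma harm_lipschitz al be h g c z w r B : has_series al be h g ->
  (forall n, Cmod (al (S n)) + Cmod (be (S n)) <= c n) ->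
  Cmod z <= r -> Cmod w <= r -> r < 1 ->
  (forall m, rsum (fun n => c n * (INR (S n) * r ^ n)) m <= B) ->
  Cmod (harm h g z - harm h g w) <= B * Cmod (z - w).
Proof.
intros H Hc Hz Hw Hr HB.
assert (Hr0 : 0 <= r) by (pose proof (Cmod_ge_0 z); lra).
eapply Cmod_cseries_abs.
{ apply cseries_minus.
  - apply (harm_cseries al be h g z H); unfold disk; lra.
  - apply (harm_cseries al be h g w H); unfold disk; lra. }
intros m; unfold trig_term.
apply Rle_trans with (2 := Rmult_le_compat_r _ _ _ (Cmod_ge_0 (z - w)) (HB m)).
rewrite Rmult_comm, <- rsum_scal; apply rsum_le; intros n _.
replace (al (S n) * z ^ S n + Cconj (be (S n) * z ^ S n)
   - (al (S n) * w ^ S n + Cconj (be (S n) * w ^ S n)))%C with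
  (al (S n) * (z ^ S n - w ^ S n) + Cconj (be (S n) * (z ^ S n - w ^ S n)))%C
  by (rewrite !Cmult_conj, Cminus_conj; ring).
eapply Rle_trans; [apply Cmod_triangle|].
rewrite Cmod_conj, !Cmod_mult, <- Rmult_plus_distr_r.
pose proof (Cmod_pow_sub_le z w r (S n) Hz Hw) as Hp.
replace (S n - 1)%nat with n in Hp by lia.
rewrite (Rmult_comm (Cmod (z - w))), Rmult_assoc.
apply Rmult_le_compat; auto using Cmod_ge_0.
pose proof (Cmod_ge_0 (al (S n))); pose proof (Cmod_ge_0 (be (S n))); lra.
Qed.

(** * Bessel's inequality on a circle *)

Lemma Cmod2_Re z : Cmod z ^ 2 = Re (z * Cconj z).
Proof. rewrite Cmod2_alt; unfold Re, Im, Cconj, Cmult; simpl; ring. Qed.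

Lemma Cmod2_plus z w :
  Cmod (z + w) ^ 2 = Cmod z ^ 2 + Cmod w ^ 2 + 2 * Re (z * Cconj w).
Proof. rewrite !Cmod2_alt; unfold Re, Im, Cconj, Cmult, Cplus; simpl; ring. Qed.

(** The order is [K + 1], so that sums over the indices [0], ..., [K] run over
    all powers once. *)
Definition root_of_unity (K : nat) : C :=
  (cos (2 * PI / INR (S K)), sin (2 * PI / INR (S K))).

Lemma cos_sin_pow t n : ((cos t, sin t) ^ n)%C = (cos (INR n * t), sin (INR n * t)).
Proof.
induction n as [|n IH].
- simpl; rewrite Rmult_0_l, cos_0, sin_0; easy.
- rewrite Cpow_S, IH, S_INR.
  replace ((INR n + 1) * t) with (t + INR n * t) by ring.
  rewrite cos_plus, sin_plus; unfold Cmult; simpl; f_equal; ring.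
Qed.

Lemma Cmod_cos_sin t : Cmod (cos t, sin t) = 1.
Proof.
unfold Cmod; simpl fst; simpl snd; rewrite <- sqrt_1; f_equal.
pose proof (sin2_cos2 t); unfold Rsqr in *; lra.
Qed.

(** The [d]-th power has argument [2 x] with [0 < x < PI], and
    [cos (2 x) = 1 - 2 (sin x)^2 < 1]. *)
Lemma root_of_unity_order K d : (0 < d < S K)%nat ->
  (root_of_unity K ^ d)%C <> RtoC 1.
Proof.
intros Hd E; unfold root_of_unity in E; rewrite cos_sin_pow in E.
assert (Hc := f_equal fst E); cbn [fst RtoC] in Hc.
set (x := INR d * (2 * PI / INR (S K))) in *.
assert (HK : 0 < INR (S K)) by (apply lt_0_INR; lia).
assert (Hd0 : 0 < INR d) by (apply lt_0_INR; lia).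
assert (HdK : INR d < INR (S K)) by (apply lt_INR; lia).
pose proof PI_RGT_0.
assert (Hx : x = 2 * (PI * (INR d / INR (S K)))) by (unfold x; field; lra).
assert (0 < INR d / INR (S K)) by (apply Rdiv_lt_0_compat; lra).
assert (INR d / INR (S K) < 1) by (apply Rlt_div_l; lra).
rewrite Hx, cos_2a_sin in Hc.
assert (0 < sin (PI * (INR d / INR (S K)))) by (apply sin_gt_0; nra).
nra.
Qed.

Lemma root_of_unity_pow K : (root_of_unity K ^ S K)%C = RtoC 1.
Proof.
unfold root_of_unity; rewrite cos_sin_pow.
replace (INR (S K) * (2 * PI / INR (S K))) with (2 * PI)
  by (field; apply not_0_INR; lia).
now rewrite cos_2PI, sin_2PI.
Qed.

Definition node (K : nat) (r : R) (j : nat) : C := (r * root_of_unity K ^ j)%C.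

Lemma csum_node_pow K r d : (0 < d < S K)%nat ->
  csum (fun j => node K r j ^ d)%C K = RtoC 0.
Proof.
intros Hd; set (w := root_of_unity K).
rewrite (csum_ext _ (fun j => r ^ d * (w ^ d) ^ j)%C).
2: { intros j _; unfold node; fold w.
     rewrite Cpow_mult_l, <- !Cpow_mult_r; do 2 f_equal; lia. }
rewrite csum_scal.
assert (G := csum_geom (w ^ d)%C K).
replace ((w ^ d) ^ S K)%C with (RtoC 1) in G.
2: { rewrite <- Cpow_mult_r, Nat.mul_comm, Cpow_mult_r.
     unfold w; now rewrite root_of_unity_pow, Cpow_1_l. }
assert (Hne : (w ^ d - 1)%C <> RtoC 0).
{ intros E; apply (root_of_unity_order K d Hd); fold w.
  replace (w ^ d)%C with ((w ^ d - 1) + 1)%C by ring; rewrite E; ring. }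
change (r ^ d * csum (fun j => (w ^ d) ^ j) K = 0)%C.
rewrite <- (Cmult_1_l (csum _ K)), <- (Cinv_l _ Hne), <- Cmult_assoc, G; ring.
Qed.

Lemma csum_node_pow_conj K r d : (0 < d < S K)%nat ->
  csum (fun j => Cconj (node K r j ^ d))%C K = RtoC 0.
Proof.
intros Hd; rewrite csum_conj, csum_node_pow by easy.
apply injective_projections; simpl; ring.
Qed.

Lemma Cmod_node K r j : 0 <= r -> Cmod (node K r j) = r.
Proof.
intros Hr; unfold node, root_of_unity.
rewrite Cmod_mult, Cmod_pow, Cmod_cos_sin, Cmod_R, pow1, Rabs_pos_eq; lra.
Qed.

Lemma node_conj K r j : 0 <= r -> (node K r j * Cconj (node K r j))%C = RtoC (r ^ 2).
Proof. intros Hr; now rewrite <- Cmod2_conj, Cmod_node. Qed.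

(** Since [z * conj z = r^2] at the nodes, each of the four products is a
    constant times [z^d] or [conj z^d] with [0 < d < K + 1], and both sum to zero
    over the nodes. *)
Lemma trig_term_orthogonal A B K r n l : 0 <= r -> (0 < n < l)%nat -> (n + l < S K)%nat ->
  csum (fun j => trig_term A B n (node K r j)
    * Cconj (trig_term A B l (node K r j)))%C K = RtoC 0.
Proof.
intros Hr Hn Hl.
rewrite (csum_ext _ (fun j =>
  (A n * Cconj (A l) * RtoC (r ^ 2) ^ n) * Cconj (node K r j ^ (l - n))
  + ((A n * B l) * node K r j ^ (n + l)
  + ((Cconj (B n) * Cconj (A l)) * Cconj (node K r j ^ (n + l))
  + (Cconj (B n) * B l * RtoC (r ^ 2) ^ n) * node K r j ^ (l - n))))%C).
2: { intros j _; unfold trig_term.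
  rewrite <- (node_conj K r j Hr), Cpow_mult_l.
  assert (Hp : forall x : C, (x ^ l = x ^ n * x ^ (l - n))%C).
  { intros x; rewrite <- Cpow_add_r; f_equal; lia. }
  rewrite !Cplus_conj, !Cmult_conj, !Cpow_conj, !Cconj_conj, !Cpow_add_r, !Hp.
  ring. }
rewrite !csum_plus, !csum_scal, !csum_node_pow, !csum_node_pow_conj by lia.
ring.
Qed.

Lemma trig_term_norm A B K r n : 0 <= r -> (0 < n)%nat -> (n + n < S K)%nat ->
  rsum (fun j => Cmod (trig_term A B n (node K r j)) ^ 2) K =
  INR (S K) * ((Cmod (A n) ^ 2 + Cmod (B n) ^ 2) * r ^ (2 * n)).
Proof.
intros Hr Hn HK.
rewrite (rsum_ext _ (fun j =>
  Re (trig_term A B n (node K r j) * Cconj (trig_term A B n (node K r j)))%C))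
  by (intros; apply Cmod2_Re).
rewrite <- (Re_csum (fun j =>
  trig_term A B n (node K r j) * Cconj (trig_term A B n (node K r j)))%C).
rewrite (csum_ext _ (fun j =>
  RtoC ((Cmod (A n) ^ 2 + Cmod (B n) ^ 2) * r ^ (2 * n))
  + ((A n * B n) * node K r j ^ (n + n)
  + (Cconj (A n) * Cconj (B n)) * Cconj (node K r j ^ (n + n))))%C).
2: { intros j _; unfold trig_term.
  rewrite RtoC_mult, RtoC_plus, !Cmod2_conj, pow_mult, RtoC_pow.
  rewrite <- (node_conj K r j Hr), Cpow_mult_l, Cpow_add_r.
  rewrite !Cplus_conj, !Cmult_conj, !Cpow_conj, !Cconj_conj.
  ring. }
rewrite csum_plus, csum_plus, !csum_scal, csum_node_pow, csum_node_pow_conj by lia.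
set (x := (_ * r ^ _)%R).
rewrite !Cmult_0_r, !Cplus_0_r, Re_csum; simpl Re.
apply rsum_const.
Qed.

(** The theorem of Pythagoras, one frequency at a time.  Averaging over
    equidistant nodes replaces integration over the circle; more than
    [2 (m + 1)] nodes are taken so that the sum of two frequencies never reaches
    their number. *)
Lemma discrete_parseval A B K r m : 0 <= r -> (2 * S m < S K)%nat ->
  rsum (fun j => Cmod (csum (fun n => trig_term A B (S n) (node K r j)) m) ^ 2) K =
  INR (S K) * rsum (fun n =>
     (Cmod (A (S n)) ^ 2 + Cmod (B (S n)) ^ 2) * r ^ (2 * S n)) m.
Proof.
intros Hr; induction m as [|m IH]; intros HK.
- rewrite rsum_0, <- trig_term_norm by lia || lra.
  apply rsum_ext; intros j _; now rewrite csum_0.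
- rewrite rsum_S, Rmult_plus_distr_l, <- trig_term_norm by lia || lra.
  rewrite <- IH by lia.
  rewrite (rsum_ext _ (fun j => (Cmod (csum (fun n => trig_term A B (S n) (node K r j)) m) ^ 2
     + Cmod (trig_term A B (S (S m)) (node K r j)) ^ 2)
     + 2 * Re (csum (fun n => trig_term A B (S n) (node K r j)) m
       * Cconj (trig_term A B (S (S m)) (node K r j)))))
    by (intros j _; now rewrite csum_S, Cmod2_plus).
  rewrite !rsum_plus, rsum_scal.
  rewrite <- (Re_csum (fun j => csum (fun n => trig_term A B (S n) (node K r j)) m
     * Cconj (trig_term A B (S (S m)) (node K r j)))%C).
  assert (Z : forall i, (i <= m)%nat ->
    csum (fun j => csum (fun n => trig_term A B (S n) (node K r j)) i
      * Cconj (trig_term A B (S (S m)) (node K r j)))%C K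
    = RtoC 0).
  { induction i as [|i IHi]; intros Hi.
    - rewrite (csum_ext _ (fun j => trig_term A B 1 (node K r j)
            * Cconj (trig_term A B (S (S m)) (node K r j)))%C)
        by (intros j _; now rewrite csum_0).
      apply trig_term_orthogonal; lia || lra.
    - rewrite (csum_ext _ (fun j => csum (fun n => trig_term A B (S n) (node K r j)) i
            * Cconj (trig_term A B (S (S m)) (node K r j))
          + trig_term A B (S (S i)) (node K r j)
            * Cconj (trig_term A B (S (S m)) (node K r j)))%C)
        by (intros j _; rewrite csum_S; ring).
      rewrite csum_plus, IHi, trig_term_orthogonal by lia || lra; ring. }
  rewrite Z by lia; simpl Re; ring.
Qed.

Lemma bounded_of_eventually (f : nat -> R) N c :
  (forall n, (N <= n)%nat -> f n <= c) -> exists C, 0 < C /\ forall n, f n <= C.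
Proof.
intros H.
assert (P : exists C, 0 < C /\ forall n, (n < N)%nat -> f n <= C).
{ clear H; induction N as [|N [C [HC0 HC]]]; [exists 1; split; [lra | lia]|].
  exists (C + Rabs (f N)); pose proof (Rabs_pos (f N)).
  split; [lra|]; intros n Hn.
  destruct (Nat.eq_dec n N) as [->|Hne]; [pose proof (Rle_abs (f N)); lra|].
  specialize (HC n ltac:(lia)); lra. }
destruct P as [C [HC0 HC]]; exists (C + Rabs c); pose proof (Rabs_pos c).
split; [lra|]; intros n.
destruct (Nat.le_gt_cases N n) as [Hn|Hn].
- specialize (H n Hn); pose proof (Rle_abs c); lra.
- specialize (HC n Hn); lra.
Qed.

Lemma cseries_terms_bounded u l : cseries u l ->
  exists C, 0 < C /\ forall n, Cmod (u n) <= C.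
Proof.
rewrite cseries_iff; intros H; destruct (H 1 Rlt_0_1) as [N HN].
apply (bounded_of_eventually _ (S N) 2).
intros [|n] Hn; [lia|].
replace (u (S n)) with ((csum u (S n) - l) + - (csum u n - l))%C
  by (rewrite csum_S; ring).
eapply Rle_trans; [apply Cmod_triangle|]; rewrite Cmod_opp.
pose proof (HN n ltac:(lia)); pose proof (HN (S n) ltac:(lia)); lra.
Qed.

Lemma Cmod_trig_term_le A B n z :
  Cmod (trig_term A B n z) <= (Cmod (A n) + Cmod (B n)) * Cmod z ^ n.
Proof.
unfold trig_term; eapply Rle_trans; [apply Cmod_triangle|].
rewrite Cmod_conj, !Cmod_mult, Cmod_pow; lra.
Qed.

(** At a point [s] between [r] and [1] the terms are bounded; on the circle of
    radius [r] they then decay like [(r / s)^n], uniformly in [z]. *)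
Lemma harm_uniform_on_circle A B h g r eps : has_series A B h g ->
  0 <= r < 1 -> 0 < eps ->
  exists N, forall m z, (N <= m)%nat -> Cmod z = r ->
    Cmod (harm h g z - csum (fun n => trig_term A B (S n) z) m) <= eps.
Proof.
intros H Hr He; set (s := (1 + r) / 2).
assert (Hs : 0 < s) by (unfold s; lra).
assert (Hd : disk 1 (RtoC s)).
{ unfold disk; rewrite Cmod_R, Rabs_pos_eq; unfold s; lra. }
destruct (H _ Hd) as [HA HB].
apply cseries_terms_bounded in HA; destruct HA as [CA [HA0 HA]].
apply cseries_terms_bounded in HB; destruct HB as [CB [HB0 HB]].
set (q := r / s); set (c := CA + CB).
assert (Hq : 0 <= q < 1).
{ unfold q; split; [apply Rdiv_le_0_compat; lra|].
  apply Rlt_div_l; unfold s; lra. }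
assert (Hc : 0 < c) by (unfold c; lra).
assert (T : forall n z, Cmod z = r -> Cmod (trig_term A B (S n) z) <= c * q ^ S n).
{ intros n z Hz; eapply Rle_trans; [apply Cmod_trig_term_le|]; rewrite Hz.
  specialize (HA n); specialize (HB n).
  rewrite Cmod_mult, Cmod_pow, Cmod_R, Rabs_pos_eq in HA, HB by lra.
  replace (r ^ S n) with (s ^ S n * q ^ S n)
    by (rewrite <- Rpow_mult_distr; f_equal; unfold q; field; lra).
  rewrite <- Rmult_assoc; apply Rmult_le_compat_r; [apply pow_le; lra|].
  unfold c; lra. }
destruct (pow_lt_1_zero q) with (y := eps * (1 - q) / c) as [N HN].
{ rewrite Rabs_pos_eq; lra. }
{ apply Rdiv_lt_0_compat; [apply Rmult_lt_0_compat|]; lra. }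
exists N; intros m z Hm Hz.
assert (Hdz : disk 1 z) by (unfold disk; lra).
apply (Cmod_cseries_le _ _ _ _ m (harm_cseries A B h g z H Hdz)).
set (P := csum (fun n => trig_term A B (S n) z)).
assert (D : forall i, Cmod (P (m + i)%nat - P m)
   <= c * ((q ^ S (S m) - q ^ S (S (m + i))) / (1 - q))).
{ induction i as [|i IH].
  - rewrite Nat.add_0_r; unfold Rminus, Rdiv; rewrite Rplus_opp_r.
    replace (P m - P m)%C with (RtoC 0) by ring; rewrite Cmod_0; lra.
  - rewrite Nat.add_succ_r; unfold P at 1; rewrite csum_S; fold P.
    replace (P (m + i)%nat + trig_term A B (S (S (m + i))) z - P m)%C with
      ((P (m + i)%nat - P m) + trig_term A B (S (S (m + i))) z)%C by ring.
    eapply Rle_trans; [apply Cmod_triangle|].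
    specialize (T (S (m + i)) z Hz).
    replace (c * ((q ^ S (S m) - q ^ S (S (S (m + i)))) / (1 - q))) with
      (c * ((q ^ S (S m) - q ^ S (S (m + i))) / (1 - q)) + c * q ^ S (S (m + i)))
      by (simpl; field; lra).
    lra. }
intros n Hn; replace n with (m + (n - m))%nat by lia.
eapply Rle_trans; [apply D|].
specialize (HN (S (S m)) ltac:(lia)).
rewrite Rabs_pos_eq in HN by (apply pow_le; lra).
apply (Rmult_lt_compat_l c) in HN; [|easy].
replace (c * (eps * (1 - q) / c)) with (eps * (1 - q)) in HN by (field; lra).
assert (0 <= q ^ S (S (m + (n - m)))) by (apply pow_le; lra).
unfold Rdiv; rewrite <- Rmult_assoc; apply Rle_div_l; [lra|]. nra.
Qed.

(** The nodes in [discrete_parseval] depend on the degree of the polynomial,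
    so its passage to the limit needs the uniform approximation on the whole
    circle. *)
Lemma bessel A B h g r M : has_series A B h g -> 0 <= r < 1 ->
  (forall z, Cmod z = r -> Cmod (harm h g z) <= M) ->
  forall m, rsum (fun n =>
    (Cmod (A (S n)) ^ 2 + Cmod (B (S n)) ^ 2) * r ^ (2 * S n)) m <= M ^ 2.
Proof.
intros H Hr HM m; set (w := fun n => _).
assert (HM0 : 0 <= M).
{ apply Rle_trans with (Cmod (harm h g (RtoC r))); [apply Cmod_ge_0|].
  apply HM; rewrite Cmod_R, Rabs_pos_eq; lra. }
assert (Hw : forall k, 0 <= w k).
{ intros k; unfold w; apply Rmult_le_pos; [|apply pow_le; lra].
  apply Rplus_le_le_0_compat; apply pow2_ge_0. }
assert (Hs0 : 0 <= rsum w m).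
{ apply Rle_trans with (rsum w 0); [rewrite rsum_0; apply Hw|].
  apply rsum_mono; auto; lia. }
cut (sqrt (rsum w m) <= M).
{ intros Hq; rewrite <- (sqrt_sqrt (rsum w m)) by easy.
  pose proof (sqrt_pos (rsum w m)); nra. }
apply Rle_plus_epsilon; intros e He.
destruct (harm_uniform_on_circle A B h g r e H Hr He) as [N HN].
set (m' := Nat.max N m); set (K := (2 * S m')%nat).
assert (HP := discrete_parseval A B K r m' (proj1 Hr) ltac:(lia)); fold w in HP.
assert (HK : 0 < INR (S K)) by (apply lt_0_INR; lia).
assert (Hle : rsum w m' <= (M + e) ^ 2).
{ apply (Rmult_le_reg_l (INR (S K))); [easy|]; rewrite <- HP, <- rsum_const.
  apply rsum_le; intros j _; apply pow_incr; split; [apply Cmod_ge_0|].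
  set (z := node K r j).
  assert (Hz : Cmod z = r) by (apply Cmod_node; lra).
  specialize (HN m' z (Nat.le_max_l _ _) Hz); rewrite Cmod_sub_sym in HN.
  specialize (HM z Hz).
  set (P := csum _ m') in *.
  replace P with ((P - harm h g z) + harm h g z)%C by ring.
  eapply Rle_trans; [apply Cmod_triangle|]; lra. }
apply Rle_trans with (sqrt ((M + e) ^ 2)).
- apply sqrt_le_1_alt; eapply Rle_trans; [|exact Hle].
  apply rsum_mono; [exact Hw | apply Nat.le_max_r].
- rewrite sqrt_pow2; lra.
Qed.

(** * Square sums of the coefficients *)

(** The form in which the condition on arguments enters: as vectors of the
    plane, [x] and [y] enclose at most a right angle. *)
Lemma Re_mul_conj_nonneg_of_Arg x y :
  (x <> RtoC 0 -> y <> RtoC 0 -> Rabs (Arg (x / y)%C) <= PI / 2) ->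
  0 <= Re (x * Cconj y)%C.
Proof.
intros H.
destruct (excluded_middle_informative (x = RtoC 0)) as [->|Hx].
{ simpl; lra. }
destruct (excluded_middle_informative (y = RtoC 0)) as [->|Hy].
{ simpl; lra. }
specialize (H Hx Hy).
assert (Hxy : (x / y)%C <> RtoC 0).
{ intros E; apply Hx; replace x with (x / y * y)%C by (field; exact Hy).
  rewrite E; ring. }
destruct (Arg_spec _ Hxy) as [_ [E _]].
apply Rabs_le_between in H.
assert (0 <= Re (x / y)%C).
{ rewrite E; apply Rmult_le_pos; [apply Cmod_ge_0 | apply cos_ge_0; lra]. }
replace (x * Cconj y)%C with (RtoC (Cmod y ^ 2) * (x / y))%C
  by (rewrite Cmod2_conj; field; exact Hy).
replace (Re (RtoC (Cmod y ^ 2) * (x / y))%C) with (Cmod y ^ 2 * Re (x / y)%C)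
  by (destruct (x / y)%C; simpl; ring).
apply Rmult_le_pos; [apply pow2_ge_0 | easy].
Qed.

(** Expanding the square, all mixed terms are non-negative. *)
Lemma Cmod2_weighted_csum_ge (c : nat -> R) (u : nat -> C) q :
  (forall j, 0 <= c j) ->
  (forall i j, (i <= q)%nat -> (j <= q)%nat -> 0 <= Re (u i * Cconj (u j))%C) ->
  rsum (fun j => (c j * Cmod (u j)) ^ 2) q <= Cmod (csum (fun j => c j * u j)%C q) ^ 2.
Proof.
intros Hc; induction q as [|q IH]; intros Hu.
- rewrite rsum_0, csum_0, Cmod_mult, Cmod_R, Rabs_pos_eq by apply Hc; lra.
- rewrite rsum_S, csum_S, Cmod2_plus.
  assert (Hq := IH ltac:(intros; apply Hu; lia)).
  rewrite (Cmod_mult (c (S q))), Cmod_R, Rabs_pos_eq by apply Hc.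
  assert (G : forall i, (i <= q)%nat ->
    0 <= Re (csum (fun j => c j * u j) i * Cconj (c (S q) * u (S q)))%C).
  { assert (G0 : forall i, (i <= q)%nat ->
      0 <= Re ((c i * u i) * Cconj (c (S q) * u (S q)))%C).
    { intros i Hi; specialize (Hu i (S q) ltac:(lia) ltac:(lia)).
      replace ((c i * u i) * Cconj (c (S q) * u (S q)))%C with
        (RtoC (c i * c (S q)) * (u i * Cconj (u (S q))))%C.
      2: { rewrite Cmult_conj, RtoC_mult.
           replace (Cconj (RtoC (c (S q)))) with (RtoC (c (S q))); [ring|].
           apply injective_projections; simpl; ring. }
      replace (Re (RtoC (c i * c (S q)) * (u i * Cconj (u (S q))))%C) with
        (c i * c (S q) * Re (u i * Cconj (u (S q)))%C)
        by (destruct (u i * Cconj (u (S q)))%C; simpl; ring).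
      apply Rmult_le_pos; [apply Rmult_le_pos|]; auto. }
    induction i as [|i IHi]; intros Hi; [rewrite csum_0; auto|].
    rewrite csum_S, Cmult_plus_distr_r.
    change (Re (?x + ?y)%C) with (Re x + Re y).
    specialize (IHi ltac:(lia)); specialize (G0 (S i) Hi); lra. }
  specialize (G q (Nat.le_refl _)); lra.
Qed.

Lemma bernoulli_le e n : 0 <= e <= 1 -> 1 - INR n * e <= (1 - e) ^ n.
Proof.
intros He; induction n as [|n IH]; [simpl; lra|].
rewrite S_INR; simpl.
pose proof (pos_INR n).
assert ((1 - e) * (1 - INR n * e) <= (1 - e) * (1 - e) ^ n)
  by (apply Rmult_le_compat_l; lra).
nra.
Qed.

(** The passage to the limit [r -> 1], made explicit by Bernoulli's inequality
    at [r = 1 - eps / D]. *)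
Lemma le_of_mul_pow_le X Y n : 0 <= X ->
  (forall r, 0 < r < 1 -> X * r ^ n <= Y) -> X <= Y.
Proof.
intros HX H; apply Rle_plus_epsilon; intros eps He.
set (D := X * INR n + 2 * eps + 1); pose proof (pos_INR n).
assert (0 <= X * INR n) by (apply Rmult_le_pos; easy).
assert (HD : 0 < D) by (unfold D; lra).
assert (E1 : 0 < eps / D) by (apply Rdiv_lt_0_compat; lra).
assert (E2 : eps / D < 1) by (apply Rlt_div_l; unfold D; lra).
specialize (H (1 - eps / D) ltac:(lra)).
pose proof (bernoulli_le (eps / D) n ltac:(lra)).
assert (E : D * (eps / D) = eps) by (field; lra).
assert (X * INR n * (eps / D) <= eps).
{ rewrite <- E at 2; apply Rmult_le_compat_r; [lra | unfold D; lra]. }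
assert (X * (1 - INR n * (eps / D)) <= X * (1 - eps / D) ^ n)
  by (apply Rmult_le_compat_l; easy).
lra.
Qed.

(** The index [j] is [k - 1] for the customary numbering [k = 1], ..., [p] of
    the summands. *)
Definition polyharm (q : nat) (h g : nat -> C -> C) (z : C) : C :=
  csum (fun j => RtoC (Cmod z ^ (2 * j)) * harm (h j) (g j) z)%C q.

(** On a circle the factors [|z|^(2j)] are constants, so there the sum is an
    ordinary harmonic series. *)
Lemma polyharm_on_circle q al be h g r :
  (forall j, (j <= q)%nat -> has_series (al j) (be j) (h j) (g j)) ->
  has_series (fun n => csum (fun j => RtoC (r ^ (2 * j)) * al j n)%C q)
    (fun n => csum (fun j => RtoC (r ^ (2 * j)) * be j n)%C q)
    (fun z => csum (fun j => RtoC (r ^ (2 * j)) * h j z)%C q)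
    (fun z => csum (fun j => RtoC (r ^ (2 * j)) * g j z)%C q) /\
  forall z, Cmod z = r ->
    harm (fun z => csum (fun j => RtoC (r ^ (2 * j)) * h j z)%C q)
      (fun z => csum (fun j => RtoC (r ^ (2 * j)) * g j z)%C q) z
    = polyharm q h g z.
Proof.
intros H; split.
- assert (P : forall (u : nat -> nat -> C) (f : nat -> C -> C) z,
    (forall j, (j <= q)%nat -> power_series_from1 (u j) (f j) z) ->
    power_series_from1 (fun n => csum (fun j => RtoC (r ^ (2 * j)) * u j n)%C q)
      (fun z => csum (fun j => RtoC (r ^ (2 * j)) * f j z)%C q) z).
  { unfold power_series_from1; intros u f z; clear H.
    induction q as [|i IH]; intros Hs.
    - rewrite csum_0.
      apply (cseries_ext (fun n => RtoC (r ^ (2 * 0)) * (u O (S n) * z ^ S n))%C).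
      + intros n; rewrite csum_0; ring.
      + apply cseries_scal, Hs; lia.
    - rewrite csum_S.
      apply (cseries_ext (fun n =>
        csum (fun j => RtoC (r ^ (2 * j)) * u j (S n))%C i * z ^ S n
        + RtoC (r ^ (2 * S i)) * (u (S i) (S n) * z ^ S n))%C).
      + intros n; rewrite csum_S; ring.
      + apply cseries_plus; [apply IH; intros; apply Hs; lia|].
        apply cseries_scal, Hs; lia. }
  intros z Hz; split; apply P; intros j Hj; now destruct (H j Hj z Hz).
- intros z Hz; unfold harm at 1, polyharm; rewrite Hz, <- csum_conj, <- csum_plus.
  apply csum_ext; intros j _; unfold harm; rewrite Cmult_conj.
  replace (Cconj (RtoC (r ^ (2 * j)))) with (RtoC (r ^ (2 * j))); [ring|].
  apply injective_projections; simpl; ring.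
Qed.

(** Keep two terms of Bessel's inequality on the circle of radius [r], or two
    summands of a single term if [n = 0], and let [r] tend to [1]. *)
Lemma coefficient_square_bound q al be h g M n j :
  (forall j, (j <= q)%nat -> has_series (al j) (be j) (h j) (g j)) ->
  (forall n i j, (i <= q)%nat -> (j <= q)%nat ->
     0 <= Re (al i (S n) * Cconj (al j (S n)))%C) ->
  (forall n i j, (i <= q)%nat -> (j <= q)%nat ->
     0 <= Re (be i (S n) * Cconj (be j (S n)))%C) ->
  (forall z, disk 1 z -> Cmod (polyharm q h g z) <= M) ->
  (j <= q)%nat -> (0 < n + j)%nat ->
  (Cmod (al O 1%nat) ^ 2 + Cmod (be O 1%nat) ^ 2)
  + (Cmod (al j (S n)) ^ 2 + Cmod (be j (S n)) ^ 2) <= M ^ 2.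
Proof.
intros Hs Ha Hb HM Hj Hnj.
set (X1 := Cmod (al O 1%nat) ^ 2 + _); set (X2 := Cmod (al j (S n)) ^ 2 + _).
assert (H1 : 0 <= X1) by (apply Rplus_le_le_0_compat; apply pow2_ge_0).
assert (H2 : 0 <= X2) by (apply Rplus_le_le_0_compat; apply pow2_ge_0).
apply (le_of_mul_pow_le _ _ (2 * (2 * j) + 2 * S n)); [lra|].
intros r Hr.
destruct (polyharm_on_circle q al be h g r Hs) as [Hser Hcirc].
assert (HB := bessel _ _ _ _ r M Hser ltac:(lra)
  ltac:(intros z Hz; rewrite Hcirc by easy; apply HM; unfold disk; lra) n).
set (A := fun n => csum (fun j => RtoC (r ^ (2 * j)) * al j n)%C q) in HB.
set (B := fun n => csum (fun j => RtoC (r ^ (2 * j)) * be j n)%C q) in HB.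
cbv beta in HB; change (rsum (fun n => (Cmod (A (S n)) ^ 2 + Cmod (B (S n)) ^ 2)
   * r ^ (2 * S n)) n <= M ^ 2) in HB.
(* [sa n], [sb n] split the square sum at frequency [n + 1] by the power of [|z|]. *)
set (sa := fun n j => (r ^ (2 * j) * Cmod (al j (S n))) ^ 2).
set (sb := fun n j => (r ^ (2 * j) * Cmod (be j (S n))) ^ 2).
assert (Hpow : forall i, 0 <= r ^ i) by (intros; apply pow_le; lra).
assert (HA : forall n, rsum (sa n) q <= Cmod (A (S n)) ^ 2).
{ intros i; apply (Cmod2_weighted_csum_ge (fun j => r ^ (2 * j)) (fun j => al j (S i)));
    auto. }
assert (HBb : forall n, rsum (sb n) q <= Cmod (B (S n)) ^ 2).
{ intros i; apply (Cmod2_weighted_csum_ge (fun j => r ^ (2 * j)) (fun j => be j (S i)));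
    auto. }
assert (Hsa : forall n j, 0 <= sa n j) by (intros; apply pow2_ge_0).
assert (Hsb : forall n j, 0 <= sb n j) by (intros; apply pow2_ge_0).
assert (E1 : sa O O + sb O O = X1) by (unfold sa, sb, X1; simpl; ring).
assert (E2 : sa n j + sb n j = X2 * r ^ (2 * (2 * j))).
{ unfold sa, sb, X2; rewrite !Rpow_mult_distr, <- !pow_mult.
  replace (2 * j * 2)%nat with (2 * (2 * j))%nat by lia; ring. }
set (w := fun n => _) in HB.
assert (Hw : forall i, 0 <= w i).
{ intros i; unfold w; apply Rmult_le_pos; [|apply Hpow].
  apply Rplus_le_le_0_compat; apply pow2_ge_0. }
assert (Hpow1 : forall i, r ^ i <= 1).
{ intros i; rewrite <- (pow1 i); apply pow_incr; lra. }
rewrite pow_add.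
assert (Hr2 : r ^ (2 * (2 * j)) * r ^ (2 * S n) <= r ^ 2).
{ replace (2 * S n)%nat with (2 + 2 * n)%nat by lia; rewrite pow_add.
  pose proof (Hpow1 (2 * (2 * j))%nat); pose proof (Hpow1 (2 * n)%nat).
  pose proof (Hpow (2 * (2 * j))%nat); pose proof (Hpow (2 * n)%nat); pose proof (Hpow 2%nat).
  apply Rle_trans with (1 * (r ^ 2 * 1)); [|lra].
  apply Rmult_le_compat; auto; [apply Rmult_le_pos; auto|].
  apply Rmult_le_compat_l; auto. }
assert (Hmain : X1 * r ^ 2 + X2 * r ^ (2 * (2 * j)) * r ^ (2 * S n) <= rsum w n).
{ destruct (Nat.eq_dec n 0) as [En|Hn].
  - assert (Hj0 : (0 < j <= q)%nat) by lia; subst n.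
    rewrite rsum_0; unfold w; change (2 * 1)%nat with 2%nat.
    rewrite <- Rmult_plus_distr_r; apply Rmult_le_compat_r; [apply Hpow|].
    rewrite <- E1, <- E2.
    pose proof (rsum_ge_two_terms (sa O) q j (Hsa O) Hj0).
    pose proof (rsum_ge_two_terms (sb O) q j (Hsb O) Hj0).
    pose proof (HA O); pose proof (HBb O); lra.
  - eapply Rle_trans; [|apply (rsum_ge_two_terms w n n Hw); lia].
    unfold w; change (2 * 1)%nat with 2%nat.
    apply Rplus_le_compat; (apply Rmult_le_compat_r; [apply Hpow|]).
    + rewrite <- E1.
      pose proof (rsum_ge_term (sa O) q O (Hsa O) ltac:(lia)).
      pose proof (rsum_ge_term (sb O) q O (Hsb O) ltac:(lia)).
      pose proof (HA O); pose proof (HBb O); lra.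
    + rewrite <- E2.
      pose proof (rsum_ge_term (sa n) q j (Hsa n) Hj).
      pose proof (rsum_ge_term (sb n) q j (Hsb n) Hj).
      pose proof (HA n); pose proof (HBb n); lra. }
assert (X1 * (r ^ (2 * (2 * j)) * r ^ (2 * S n)) <= X1 * r ^ 2)
  by (apply Rmult_le_compat_l; easy).
lra.
Qed.

(** * Linear part and remainder *)

Definition lin (al be z : C) : C := (al * z + Cconj (be * z))%C.

Definition drop_linear (f : nat -> C -> C) (a1 : C) (j : nat) (z : C) : C :=
  match j with O => f O z - a1 * z | S _ => f j z end%C.

(** Subtracting the linear part leaves a mapping of the same kind, in which
    only the first summand has changed. *)
Definition remainder (q : nat) (al be : nat -> nat -> C) (h g : nat -> C -> C) : C -> C :=
  polyharm q (drop_linear h (al O 1%nat)) (drop_linear g (be O 1%nat)).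

Definition drop_linear_coef (al : nat -> nat -> C) (j n : nat) : C :=
  match j, n with O, 1%nat => RtoC 0 | _, _ => al j n end.

Lemma polyharm_split q al be h g z :
  polyharm q h g z = (lin (al O 1%nat) (be O 1%nat) z + remainder q al be h g z)%C.
Proof.
unfold remainder, polyharm, lin; induction q as [|q IH].
- rewrite !csum_0; unfold drop_linear, harm; simpl.
  rewrite !Cminus_conj; ring.
- rewrite !csum_S, IH; unfold drop_linear, harm; ring.
Qed.

Lemma cseries_single x : cseries (fun n => match n return C with O => x | S _ => RtoC 0 end) x.
Proof.
apply cseries_iff; intros eps He; exists O; intros n _.
replace (csum _ n) with x.
- replace (x - x)%C with (RtoC 0) by ring; now rewrite Cmod_0.
- induction n as [|n IH]; [now rewrite csum_0|]; rewrite csum_S, <- IH; ring.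
Qed.

Lemma drop_linear_series al f z j :
  power_series_from1 (al j) (f j) z ->
  power_series_from1 (drop_linear_coef al j) (drop_linear f (al O 1%nat) j) z.
Proof.
intros H; destruct j as [|j]; [|exact H].
unfold power_series_from1, drop_linear.
apply (cseries_ext (fun n => al O (S n) * z ^ S n
   - match n return C with O => al O 1%nat * z | S _ => RtoC 0 end)%C).
- intros [|n]; simpl; ring.
- apply cseries_minus; [exact H | apply cseries_single].
Qed.

Lemma drop_linear_has_series al be h g j :
  has_series (al j) (be j) (h j) (g j) ->
  has_series (drop_linear_coef al j) (drop_linear_coef be j)
    (drop_linear h (al O 1%nat) j) (drop_linear g (be O 1%nat) j).
Proof.
intros H z Hz; destruct (H z Hz); split; now apply drop_linear_series.
Qed.

(** A bound [c] for the coefficients leaves this majorant; in the first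
    summand the linear term is gone. *)
Definition majorant (c : R) (j n : nat) : R :=
  match j, n with O, O => 0 | _, _ => c end.

Lemma drop_linear_coef_le al be c j n :
  ((0 < n + j)%nat -> Cmod (al j (S n)) + Cmod (be j (S n)) <= c) ->
  Cmod (drop_linear_coef al j (S n)) + Cmod (drop_linear_coef be j (S n))
  <= majorant c j n.
Proof.
intros H; destruct j as [|j], n as [|n]; simpl in *; try (apply H; lia).
rewrite Cmod_0; lra.
Qed.

Definition size_bound (j : nat) (r : R) : R :=
  match j with O => r ^ 2 / (1 - r) | S _ => r / (1 - r) end.

Definition lip_bound (j : nat) (r : R) : R :=
  match j with O => (2 * r - r ^ 2) / (1 - r) ^ 2 | S _ => 1 / (1 - r) ^ 2 end.

(** For [j = 0] the sum is the full geometric sum without its first term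
    [c * r]. *)
Lemma majorant_size c j r m : 0 <= c -> 0 <= r < 1 ->
  rsum (fun n => majorant c j n * r ^ S n) m <= c * size_bound j r.
Proof.
intros Hc Hr.
assert (G : rsum (fun n => c * (r * r ^ n)) m <= c * (r / (1 - r))).
{ rewrite rsum_scal, rsum_scal; apply Rmult_le_compat_l; [easy|].
  apply Rmult_le_compat_l; [lra | now apply geom_sum_le]. }
destruct j as [|j]; [|exact G].
replace (rsum _ m) with (rsum (fun n => c * (r * r ^ n)) m - c * r).
{ simpl size_bound.
  replace (c * (r * (r * 1) / (1 - r))) with (c * (r / (1 - r)) - c * r)
    by (field; lra); lra. }
clear G; induction m as [|m IH]; [rewrite !rsum_0; simpl; ring|].
rewrite !rsum_S, <- IH; simpl; ring.
Qed.

Lemma majorant_lip c j r m : 0 <= c -> 0 <= r < 1 ->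
  rsum (fun n => majorant c j n * (INR (S n) * r ^ n)) m <= c * lip_bound j r.
Proof.
intros Hc Hr.
assert (G : rsum (fun n => c * (INR (S n) * r ^ n)) m <= c * (1 / (1 - r) ^ 2)).
{ rewrite rsum_scal; apply Rmult_le_compat_l; [easy|].
  unfold Rdiv; rewrite Rmult_1_l; now apply deriv_geom_sum_le. }
destruct j as [|j]; [|exact G].
replace (rsum _ m) with (rsum (fun n => c * (INR (S n) * r ^ n)) m - c).
{ unfold lip_bound.
  replace (c * ((2 * r - r ^ 2) / (1 - r) ^ 2)) with (c * (1 / (1 - r) ^ 2) - c)
    by (field; lra); lra. }
clear G; induction m as [|m IH]; [rewrite !rsum_0; simpl; ring|].
rewrite !rsum_S, <- IH; unfold majorant; ring.
Qed.

(** The bracket in the equation for the radius of univalence: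
    see [radius_fun_eq], and [remainder_lipschitz] for its role. *)
Definition lip_sum (q : nat) (r : R) : R :=
  (2 * r - r ^ 2) / (1 - r) ^ 2
  + sum_n_m (fun k : nat => r ^ (2 * k) / (1 - r) ^ 2) 1 q
  + 2 * sum_n_m (fun k : nat => INR k * r ^ (2 * k) / (1 - r)) 1 q.

Definition size_sum (q : nat) (r : R) : R :=
  r * (r / (1 - r) + sum_n_m (fun k : nat => r ^ (2 * k) / (1 - r)) 1 q).

(** The [j]-th summand is the product rule for [|z|^(2j)], which is bounded by
    [r^(2j)] with Lipschitz constant [2j r^(2j-1)], and a harmonic series with
    bounds [size_bound] and [lip_bound]. *)
Lemma rsum_lip_bound q r : 0 <= r < 1 ->
  rsum (fun j => r ^ (2 * j) * lip_bound j r
     + INR (2 * j) * r ^ (2 * j - 1) * size_bound j r) q = lip_sum q r.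
Proof.
intros Hr; unfold lip_sum; induction q as [|q IH].
- rewrite rsum_0, !sum1_0; simpl; field; lra.
- rewrite rsum_S, IH, !sum1_S; unfold lip_bound, size_bound.
  replace (r ^ (2 * S q)) with (r ^ (2 * S q - 1) * r).
  2: { replace (2 * S q)%nat with (S (2 * S q - 1)) at 2 by lia; simpl; ring. }
  rewrite (mult_INR 2); simpl (INR 2); field; lra.
Qed.

Lemma rsum_size_bound q r : 0 <= r < 1 ->
  rsum (fun j => r ^ (2 * j) * size_bound j r) q = size_sum q r.
Proof.
intros Hr; unfold size_sum; induction q as [|q IH].
- rewrite rsum_0, !sum1_0; simpl; field; lra.
- rewrite rsum_S, IH, !sum1_S; unfold size_bound; field; lra.
Qed.

Lemma remainder_bound q al be h g c z r :
  (forall j, (j <= q)%nat -> has_series (al j) (be j) (h j) (g j)) ->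
  (forall n j, (j <= q)%nat -> (0 < n + j)%nat ->
     Cmod (al j (S n)) + Cmod (be j (S n)) <= c) ->
  0 <= c -> Cmod z <= r -> r < 1 ->
  Cmod (remainder q al be h g z) <= c * size_sum q r.
Proof.
intros Hs Hc Hc0 Hz Hr.
assert (Hr0 : 0 <= r) by (pose proof (Cmod_ge_0 z); lra).
rewrite <- rsum_size_bound, <- rsum_scal by lra.
eapply Rle_trans; [apply Cmod_csum_le|].
apply rsum_le; intros j Hj.
rewrite Cmod_mult, Cmod_R, Rabs_pos_eq by apply pow_le, Cmod_ge_0.
replace (c * (r ^ (2 * j) * size_bound j r)) with
  (r ^ (2 * j) * (c * size_bound j r)) by ring.
apply Rmult_le_compat; [apply pow_le, Cmod_ge_0 | apply Cmod_ge_0 | |].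
- apply pow_incr; split; [apply Cmod_ge_0 | easy].
- apply (harm_bound _ _ _ _ (majorant c j) z r _
    (drop_linear_has_series al be h g j (Hs j Hj))); auto.
  + intros n; apply drop_linear_coef_le; auto.
  + intros m; apply majorant_size; lra.
Qed.

(** Each summand is split as
    [|z|^(2j) (H z - H w) + (|z|^(2j) - |w|^(2j)) H w]. *)
Lemma remainder_lipschitz q al be h g c z w r :
  (forall j, (j <= q)%nat -> has_series (al j) (be j) (h j) (g j)) ->
  (forall n j, (j <= q)%nat -> (0 < n + j)%nat ->
     Cmod (al j (S n)) + Cmod (be j (S n)) <= c) ->
  0 <= c -> Cmod z <= r -> Cmod w <= r -> r < 1 ->
  Cmod (remainder q al be h g z - remainder q al be h g w)
  <= c * lip_sum q r * Cmod (z - w).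
Proof.
intros Hs Hc Hc0 Hz Hw Hr.
assert (Hr0 : 0 <= r) by (pose proof (Cmod_ge_0 z); lra).
unfold remainder, polyharm.
set (H := fun j => harm (drop_linear h (al O 1%nat) j) (drop_linear g (be O 1%nat) j)).
replace (csum _ q - csum _ q)%C with (csum (fun j =>
  RtoC (Cmod z ^ (2 * j)) * (H j z - H j w)
  + RtoC (Cmod z ^ (2 * j) - Cmod w ^ (2 * j)) * H j w)%C q).
2: { replace (csum _ q - csum _ q)%C with
       (csum (fun j => RtoC (Cmod z ^ (2 * j)) * H j z)%C q
        + (-1) * csum (fun j => RtoC (Cmod w ^ (2 * j)) * H j w)%C q)%C
       by (unfold H; ring).
     rewrite <- csum_scal, <- csum_plus; apply csum_ext; intros j _.
     rewrite RtoC_minus; ring. }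
rewrite <- rsum_lip_bound by lra.
rewrite (Rmult_comm c), Rmult_assoc, Rmult_comm, <- rsum_scal.
eapply Rle_trans; [apply Cmod_csum_le|].
apply rsum_le; intros j Hj.
pose proof (drop_linear_has_series al be h g j (Hs j Hj)) as Hsj.
assert (Hmaj : forall n, Cmod (drop_linear_coef al j (S n))
   + Cmod (drop_linear_coef be j (S n)) <= majorant c j n).
{ intros n; apply drop_linear_coef_le; auto. }
assert (L : Cmod (H j z - H j w) <= c * lip_bound j r * Cmod (z - w)).
{ apply (harm_lipschitz _ _ _ _ (majorant c j) z w r _ Hsj); auto.
  intros m; apply majorant_lip; lra. }
assert (S : Cmod (H j w) <= c * size_bound j r).
{ apply (harm_bound _ _ _ _ (majorant c j) w r _ Hsj); auto.
  intros m; apply majorant_size; lra. }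
assert (P : Rabs (Cmod z ^ (2 * j) - Cmod w ^ (2 * j))
   <= INR (2 * j) * r ^ (2 * j - 1) * Cmod (z - w)).
{ assert (T : Rabs (Cmod z - Cmod w) <= Cmod (z - w)).
  { apply Rabs_le; split.
    - pose proof (Cmod_triangle (w - z) z) as T; rewrite Cmod_sub_sym in T.
      replace (w - z + z)%C with w in T by ring; lra.
    - pose proof (Cmod_triangle (z - w) w) as T.
      replace (z - w + w)%C with z in T by ring; lra. }
  pose proof (Cmod_pow_sub_le (RtoC (Cmod z)) (RtoC (Cmod w)) r (2 * j)) as Q.
  rewrite <- !RtoC_pow, <- !RtoC_minus, !Cmod_R, !(Rabs_pos_eq (Cmod _)) in Q
    by apply Cmod_ge_0.
  eapply Rle_trans; [apply Q; auto|].
  apply Rmult_le_compat_l; [|exact T].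
  apply Rmult_le_pos; [apply pos_INR | now apply pow_le]. }
eapply Rle_trans; [apply Cmod_triangle|].
rewrite !Cmod_mult, !Cmod_R, (Rabs_pos_eq (Cmod z ^ _)) by apply pow_le, Cmod_ge_0.
replace (c * Cmod (z - w) * (r ^ (2 * j) * lip_bound j r
    + INR (2 * j) * r ^ (2 * j - 1) * size_bound j r)) with
  (r ^ (2 * j) * (c * lip_bound j r * Cmod (z - w))
   + (INR (2 * j) * r ^ (2 * j - 1) * Cmod (z - w)) * (c * size_bound j r)) by ring.
apply Rplus_le_compat; apply Rmult_le_compat; auto using Cmod_ge_0, Rabs_pos.
- apply pow_le, Cmod_ge_0.
- apply pow_incr; split; [apply Cmod_ge_0 | easy].
Qed.

(** * The Jacobian at the origin *)

Lemma derive_0_of_quadratic (f : R -> R) l B :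
  (forall t, Rabs t <= 1 / 2 -> Rabs (f t - l * t) <= B * t ^ 2) ->
  Derive f 0 = l.
Proof.
intros H; apply is_derive_unique, is_derive_Reals.
assert (f0 : f 0 = 0).
{ specialize (H 0); rewrite Rabs_R0 in H; specialize (H ltac:(lra)).
  replace (f 0 - l * 0) with (f 0) in H by ring.
  replace (B * 0 ^ 2) with 0 in H by ring.
  pose proof (Rabs_pos (f 0)); apply Rabs_eq_0; lra. }
intros eps He.
assert (Hd : 0 < Rmin (1 / 2) (eps / (Rabs B + 1))).
{ apply Rmin_pos; [lra|]; apply Rdiv_lt_0_compat; [easy|].
  pose proof (Rabs_pos B); lra. }
exists (mkposreal _ Hd); intros t Ht Htd; simpl in Htd.
pose proof (Rmin_l (1 / 2) (eps / (Rabs B + 1))).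
pose proof (Rmin_r (1 / 2) (eps / (Rabs B + 1))).
rewrite Rplus_0_l, f0, Rminus_0_r.
replace (f t / t - l) with ((f t - l * t) / t) by (field; easy).
specialize (H t ltac:(lra)).
assert (Hp : 0 < Rabs t) by now apply Rabs_pos_lt.
rewrite Rabs_div by easy.
apply Rlt_div_l; [easy|].
eapply Rle_lt_trans; [exact H|].
rewrite <- pow2_abs.
pose proof (Rle_abs B); pose proof (Rabs_pos B).
assert ((Rabs B + 1) * Rabs t < eps).
{ rewrite Rmult_comm; apply Rlt_div_r; lra. }
apply Rle_lt_trans with (Rabs B * Rabs t * Rabs t).
{ simpl; rewrite Rmult_1_r, <- Rmult_assoc.
  apply Rmult_le_compat_r; [lra|]; apply Rmult_le_compat_r; lra. }
apply Rmult_lt_compat_r; [easy|]; nra.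
Qed.

Lemma im_le_Cmod z : Rabs (Im z) <= Cmod z.
Proof.
replace (Im z) with (- Re (Ci * z)%C) by (unfold Re, Im; simpl; ring).
rewrite Rabs_Ropp; eapply Rle_trans; [apply re_le_Cmod|].
rewrite Cmod_mult, Cmod_Ci; lra.
Qed.

(** A quadratically small error does not change the partial derivatives at
    [0], so [dz] and [dzbar] are those of the linear map. *)
Lemma jacobian_of_quadratic F al be B :
  (forall z, Cmod z <= 1 / 2 -> Cmod (F z - lin al be z) <= B * Cmod z ^ 2) ->
  jacobian F (RtoC 0) = Cmod al ^ 2 - Cmod be ^ 2.
Proof.
intros H.
assert (Hx : forall t, Cmod (t, 0) = Rabs t) by (intros; apply Cmod_R).
assert (Hy : forall t, Cmod (0, t) = Rabs t).
{ intros t; replace (0, t) with (Ci * RtoC t)%C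
    by (apply injective_projections; simpl; ring).
  rewrite Cmod_mult, Cmod_Ci, Cmod_R; ring. }
assert (Ex : dx F (RtoC 0) = (al + Cconj be)%C).
{ apply injective_projections; simpl;
  apply (derive_0_of_quadratic _ _ B); intros t Ht;
  rewrite <- (pow2_abs t), <- (Hx t); rewrite <- Hx in Ht;
  (eapply Rle_trans; [|apply (H _ Ht)]).
  - eapply Rle_trans; [|apply re_le_Cmod]; apply Req_le; f_equal.
    unfold lin, Re, Im; simpl; ring.
  - eapply Rle_trans; [|apply im_le_Cmod]; apply Req_le; f_equal.
    unfold lin, Re, Im; simpl; ring. }
assert (Ey : dy F (RtoC 0) = (Ci * (al - Cconj be))%C).
{ apply injective_projections; simpl;
  apply (derive_0_of_quadratic _ _ B); intros t Ht;
  rewrite <- (pow2_abs t), <- (Hy t); rewrite <- Hy in Ht;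
  (eapply Rle_trans; [|apply (H _ Ht)]).
  - eapply Rle_trans; [|apply re_le_Cmod]; apply Req_le; f_equal.
    unfold lin, Re, Im; simpl; ring.
  - eapply Rle_trans; [|apply im_le_Cmod]; apply Req_le; f_equal.
    unfold lin, Re, Im; simpl; ring. }
assert (Hi : (Ci * Ci)%C = (-1)%C)
  by (apply injective_projections; simpl; ring).
unfold jacobian, dz, dzbar; rewrite Ex, Ey, !Cmult_assoc, Hi.
replace ((al + Cconj be - -1 * (al - Cconj be)) / 2)%C with al by field.
replace ((al + Cconj be + -1 * (al - Cconj be)) / 2)%C with (Cconj be) by field.
now rewrite Cmod_conj.
Qed.

Lemma size_sum_quadratic q r : 0 <= r <= 1 / 2 ->
  0 <= size_sum q r <= 2 * INR (S q) * r ^ 2.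
Proof.
intros Hr; unfold size_sum.
assert (Hi : 0 < / (1 - r) <= 2).
{ split; [apply Rinv_0_lt_compat; lra|].
  replace 2 with (/ / 2) by field; apply Rinv_le_contravar; lra. }
assert (G : 0 <= r / (1 - r) + sum_n_m (fun k : nat => r ^ (2 * k) / (1 - r)) 1 q
   <= 2 * INR (S q) * r).
{ induction q as [|q IH].
  - rewrite sum1_0; unfold Rdiv; simpl INR; nra.
  - rewrite sum1_S, (S_INR (S q)).
    assert (0 <= r ^ (2 * S q) <= r).
    { split; [apply pow_le; lra|].
      replace (2 * S q)%nat with (S (2 * q + 1)) by lia; rewrite <- tech_pow_Rmult.
      assert (r ^ (2 * q + 1) <= 1) by (rewrite <- (pow1 (2 * q + 1)); apply pow_incr; lra).
      nra. }
    assert (0 <= r ^ (2 * S q) / (1 - r) <= 2 * r) by (unfold Rdiv; nra).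
    nra. }
split; [apply Rmult_le_pos; lra|].
replace (2 * INR (S q) * r ^ 2) with (r * (2 * INR (S q) * r)) by ring.
apply Rmult_le_compat_l; lra.
Qed.

(** * Stretching of the linear part *)

Lemma lin_lower al be z :
  Rabs (Cmod al - Cmod be) * Cmod z <= Cmod (lin al be z).
Proof.
unfold lin; assert (Ha := Cmod_triangle (al * z + Cconj (be * z)) (- Cconj (be * z))).
assert (Hb := Cmod_triangle (al * z + Cconj (be * z)) (- (al * z))).
replace (al * z + Cconj (be * z) + - Cconj (be * z))%C with (al * z)%C in Ha by ring.
replace (al * z + Cconj (be * z) + - (al * z))%C with (Cconj (be * z)) in Hb by ring.
rewrite Cmod_opp, Cmod_conj, !Cmod_mult in *.
pose proof (Cmod_ge_0 z).
unfold Rabs; destruct (Rcase_abs _); lra.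
Qed.

Lemma lin_minus al be z w : lin al be (z - w) = (lin al be z - lin al be w)%C.
Proof. unfold lin; rewrite !Cmult_conj, Cminus_conj; ring. Qed.

(** Cramer's formula.  For a determinant [1] or [-1] dividing by it is the same
    as multiplying by it. *)
Definition lin_inv (al be w : C) : C :=
  (RtoC (Cmod al ^ 2 - Cmod be ^ 2) * (Cconj al * w - Cconj (be * w)))%C.

Lemma lin_lin_inv al be w : Rabs (Cmod al ^ 2 - Cmod be ^ 2) = 1 ->
  lin al be (lin_inv al be w) = w.
Proof.
intros H; unfold lin, lin_inv; set (d := _ - _) in *.
assert (Hd : (RtoC d * RtoC (Cmod al ^ 2 - Cmod be ^ 2))%C = RtoC 1).
{ rewrite <- RtoC_mult; f_equal; fold d.
  rewrite <- (Rabs_pos_eq (d * d)) by nra; rewrite Rabs_mult, H; ring. }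
rewrite RtoC_minus, !Cmod2_conj in Hd.
rewrite !Cmult_conj, Cminus_conj, !Cmult_conj, !Cconj_conj.
replace (Cconj (RtoC d)) with (RtoC d) by (apply injective_projections; simpl; ring).
rewrite <- (Cmult_1_l w) at 5; rewrite <- Hd; ring.
Qed.

(** Put [lam = |x - y|], so that [lam (x + y) = 1] and
    [2 (x^2 + y^2) = lam^2 + (x + y)^2].  Then
    [(u + v)^2 <= 2 (u^2 + v^2) <= 2 M^2 - lam^2 - (x + y)^2], and this falls short
    of [(M^4 - 1) lam^2] by the square of [M^2 lam - (x + y)]. *)
Lemma coefficient_pair_bound M x y u v : 0 <= x -> 0 <= y -> 1 <= M ->
  Rabs (x ^ 2 - y ^ 2) = 1 -> (x ^ 2 + y ^ 2) + (u ^ 2 + v ^ 2) <= M ^ 2 ->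
  u + v <= sqrt (M ^ 4 - 1) * Rabs (x - y).
Proof.
intros Hx Hy HM HJ Hs; set (lam := Rabs (x - y)).
assert (Hl : lam * (x + y) = 1).
{ rewrite <- HJ; replace (x ^ 2 - y ^ 2) with ((x - y) * (x + y)) by ring.
  rewrite Rabs_mult, (Rabs_pos_eq (x + y)) by lra; easy. }
assert (Hl2 : lam ^ 2 = (x - y) ^ 2) by apply pow2_abs.
assert (Hl0 : 0 <= lam) by apply Rabs_pos.
assert (HM4 : 0 <= M ^ 4 - 1).
{ rewrite <- (pow1 4); pose proof (pow_incr 1 M 4 ltac:(lra)); lra. }
rewrite <- (sqrt_pow2 lam) by easy; rewrite <- sqrt_mult by (easy || apply pow2_ge_0).
apply Rle_trans with (sqrt ((u + v) ^ 2)).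
{ replace ((u + v) ^ 2) with (Rsqr (u + v)) by (unfold Rsqr; ring).
  rewrite sqrt_Rsqr_abs; apply Rle_abs. }
apply sqrt_le_1_alt.
assert (E : (M ^ 4 - 1) * lam ^ 2 - (2 * M ^ 2 - lam ^ 2 - (x + y) ^ 2)
  = (M ^ 2 * lam - (x + y)) ^ 2).
{ replace ((M ^ 2 * lam - (x + y)) ^ 2) with
   (M ^ 4 * lam ^ 2 - 2 * M ^ 2 * (lam * (x + y)) + (x + y) ^ 2) by ring.
  rewrite Hl; ring. }
pose proof (pow2_ge_0 (M ^ 2 * lam - (x + y))); pose proof (pow2_ge_0 (u - v)).
nra.
Qed.

(** The square [t] of [x + y] satisfies [t + 1 / t <= 2 M^2], hence
    [t <= M^2 + sqrt (M^4 - 1) = 1 / lambda0 M ^ 2], and [|x - y| = 1 / (x + y)]. *)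
Lemma lambda0_le M x y : 0 <= x -> 0 <= y -> 1 <= M ->
  Rabs (x ^ 2 - y ^ 2) = 1 -> x ^ 2 + y ^ 2 <= M ^ 2 ->
  lambda0 M <= Rabs (x - y).
Proof.
intros Hx Hy HM HJ Hs; set (lam := Rabs (x - y)).
assert (Hl : lam * (x + y) = 1).
{ rewrite <- HJ; replace (x ^ 2 - y ^ 2) with ((x - y) * (x + y)) by ring.
  rewrite Rabs_mult, (Rabs_pos_eq (x + y)) by lra; easy. }
assert (Hl2 : lam ^ 2 = (x - y) ^ 2) by apply pow2_abs.
assert (Hl0 : 0 <= lam) by apply Rabs_pos.
assert (Hxy : 0 < x + y) by nra.
unfold lambda0.
assert (A2 : sqrt (M ^ 2 - 1) * sqrt (M ^ 2 - 1) = M ^ 2 - 1) by (apply sqrt_sqrt; nra).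
assert (B2 : sqrt (M ^ 2 + 1) * sqrt (M ^ 2 + 1) = M ^ 2 + 1) by (apply sqrt_sqrt; nra).
assert (S2 : sqrt 2 * sqrt 2 = 2) by (apply sqrt_sqrt; lra).
assert (A0 := sqrt_pos (M ^ 2 - 1)).
assert (B0 : 0 < sqrt (M ^ 2 + 1)) by (apply sqrt_lt_R0; nra).
assert (S0 := sqrt_pos 2).
set (A := sqrt (M ^ 2 - 1)) in *; set (B := sqrt (M ^ 2 + 1)) in *.
apply Rle_div_l; [lra|].
assert (G : sqrt 2 * (x + y) <= A + B).
{ apply Rsqr_incr_0; [|apply Rmult_le_pos; lra | lra]; unfold Rsqr.
  set (t := (x + y) * (x + y)).
  replace (sqrt 2 * (x + y) * (sqrt 2 * (x + y))) with ((sqrt 2 * sqrt 2) * t)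
    by (unfold t; ring).
  rewrite S2.
  assert (Ht : (t - M ^ 2) ^ 2 <= (A * B) ^ 2).
  { replace ((A * B) ^ 2) with ((A * A) * (B * B)) by ring; rewrite A2, B2.
    assert (t * lam ^ 2 = 1) by (unfold t; nra).
    assert (t * (t + lam ^ 2) <= t * (2 * M ^ 2)).
    { apply Rmult_le_compat_l; unfold t in *; nra. }
    nra. }
  assert (t - M ^ 2 <= A * B) by (assert (0 <= A * B) by nra; nra).
  replace ((A + B) * (A + B)) with (A * A + B * B + 2 * (A * B)) by ring; lra. }
replace (sqrt 2) with (lam * (sqrt 2 * (x + y)))
  by (rewrite <- (Rmult_1_r (sqrt 2)) at 2; rewrite <- Hl; ring).
apply Rmult_le_compat_l; easy.
Qed.

(** * Perturbations of an invertible linear map *)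

(** The iterates of [0] are the partial sums of a series dominated by a
    geometric one; its sum is the fixed point. *)
Lemma contraction_fixed_point (f : C -> C) r q :
  0 <= r -> 0 <= q < 1 ->
  (forall z, Cmod z <= r -> Cmod (f z) <= r) ->
  (forall z w, Cmod z <= r -> Cmod w <= r ->
     Cmod (f z - f w) <= q * Cmod (z - w)) ->
  exists z, Cmod z <= r /\ f z = z.
Proof.
intros Hr Hq Hf HL.
set (x := fun n => Nat.iter n f (RtoC 0)).
assert (xS : forall n, x (S n) = f (x n)) by easy.
assert (Hx : forall n, Cmod (x n) <= r).
{ induction n as [|n IH]; [simpl; rewrite Cmod_0; easy|].
  rewrite xS; auto. }
set (d := fun n => (x (S n) - x n)%C).
assert (Hd : forall n, Cmod (d n) <= Cmod (d O) * q ^ n).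
{ induction n as [|n IH]; [simpl; lra|].
  unfold d at 1; rewrite (xS (S n)); rewrite (xS n) at 2.
  eapply Rle_trans; [apply HL; auto|]; fold (d n).
  replace (Cmod (d O) * q ^ S n) with (q * (Cmod (d O) * q ^ n)) by (simpl; ring).
  now apply Rmult_le_compat_l. }
assert (Hs : ex_series (V := C_CompleteNormedModule) d).
{ apply (ex_series_le (V := C_CompleteNormedModule) d (fun n => Cmod (d O) * q ^ n)).
  - exact Hd.
  - apply (ex_series_scal (V := R_NormedModule) (Cmod (d O))), ex_series_geom.
    rewrite Rabs_pos_eq; lra. }
destruct Hs as [l Hl]; change (cseries d l) in Hl.
assert (Hsum : forall n, csum d n = x (S n)).
{ induction n as [|n IH].
  - rewrite csum_0; unfold d; change (x O) with (RtoC 0); ring.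
  - rewrite csum_S, IH; unfold d; ring. }
assert (Hlr : Cmod l <= r).
{ replace l with (l - RtoC 0)%C by ring.
  apply (Cmod_cseries_le d l _ _ O Hl); intros n _; rewrite Hsum.
  replace (x (S n) - RtoC 0)%C with (x (S n)) by ring; auto. }
exists l; split; [easy|].
rewrite cseries_iff in Hl.
assert (Z : Cmod (f l - l) <= 0).
{ apply Rle_plus_epsilon; intros e He.
  destruct (Hl (e / 2) ltac:(lra)) as [n Hn].
  pose proof (Hn n ltac:(lia)) as H1; pose proof (Hn (S n) ltac:(lia)) as H2.
  rewrite Hsum in H1, H2.
  replace (f l - l)%C with ((f l - f (x (S n))) + (x (S (S n)) - l))%C
    by (rewrite (xS (S n)); ring).
  eapply Rle_trans; [apply Cmod_triangle|].
  pose proof (HL l (x (S n)) Hlr (Hx _)) as H3.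
  rewrite (Cmod_sub_sym l) in H3.
  pose proof (Cmod_ge_0 (x (S n) - l)); nra. }
pose proof (Cmod_ge_0 (f l - l)).
assert (E : (f l - l)%C = RtoC 0) by (apply Cmod_eq_0; lra).
replace (f l) with ((f l - l) + l)%C by ring; rewrite E; ring.
Qed.

Lemma disk_open r : open (disk r : C_UniformSpace -> Prop).
Proof.
intros z Hz; unfold disk in *.
assert (He : 0 < (r - Cmod z) / 2) by lra.
exists (mkposreal _ He); intros w Hw; apply ball_Cmod in Hw; simpl in Hw.
replace w with ((w - z) + z)%C by ring.
eapply Rle_lt_trans; [apply Cmod_triangle|]; lra.
Qed.

(** The function that is [1] where the path is in [A] and [-1] where it is in
    [B] is locally constant, against the intermediate value theorem. *)
Lemma no_path_between_separated_sets (A B : C_UniformSpace -> Prop) (ga : R -> C) :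
  open A -> open B -> (forall t, continuous (ga : R -> C_UniformSpace) t) ->
  (forall t, A (ga t) \/ B (ga t)) -> (forall z, ~ (A z /\ B z)) ->
  A (ga 0) -> B (ga 1) -> False.
Proof.
intros HA HB Hc Hcov Hdis H0 H1.
set (f := fun t => if excluded_middle_informative (A (ga t)) then 1 else -1).
assert (fA : forall t, A (ga t) -> f t = 1).
{ intros t Ht; unfold f; destruct (excluded_middle_informative _); easy. }
assert (fB : forall t, B (ga t) -> f t = -1).
{ intros t Ht; unfold f; destruct (excluded_middle_informative _) as [a|]; [|easy].
  destruct (Hdis (ga t)); easy. }
assert (fc : continuity f).
{ intros t; apply continuity_pt_filterlim.
  destruct (Hcov t) as [Ht|Ht].
  - apply (continuous_ext_loc f (fun _ => 1)); [|apply continuous_const].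
    apply (filter_imp (fun u => A (ga u))); [intros u Hu; now rewrite fA|].
    exact (Hc t _ (HA _ Ht)).
  - apply (continuous_ext_loc f (fun _ => -1)); [|apply continuous_const].
    apply (filter_imp (fun u => B (ga u))); [intros u Hu; now rewrite fB|].
    exact (Hc t _ (HB _ Ht)). }
destruct (IVT_gen f 0 1 0 fc) as [t [_ Ht]].
{ rewrite (fA 0), (fB 1) by easy; unfold Rmin, Rmax.
  destruct (Rle_dec _ _); lra. }
destruct (Hcov t) as [E|E]; [rewrite fA in Ht | rewrite fB in Ht]; easy || lra.
Qed.

(** Extends functions from the unit interval to the whole line. *)
Definition clamp (t : R) : R := Rmax 0 (Rmin 1 t).

Lemma clamp_range t : 0 <= clamp t <= 1.
Proof. unfold clamp, Rmax, Rmin; repeat destruct (Rle_dec _ _); lra. Qed.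

Lemma clamp_lipschitz t u : Rabs (clamp t - clamp u) <= Rabs (t - u).
Proof.
unfold clamp, Rmax, Rmin, Rabs.
repeat destruct (Rle_dec _ _); repeat destruct (Rcase_abs _); lra.
Qed.

Lemma lipschitz_path_continuous (ga : R -> C) B :
  (forall t u, Cmod (ga t - ga u) <= B * Rabs (t - u)) ->
  forall t, continuous (ga : R -> C_UniformSpace) t.
Proof.
intros H t P [e He].
assert (HB : 0 < Rabs B + 1) by (pose proof (Rabs_pos B); lra).
assert (Hd : 0 < e / (Rabs B + 1)) by (apply Rdiv_lt_0_compat; [apply cond_pos | easy]).
exists (mkposreal _ Hd); intros u Hu; apply He, Cmod_ball.
change (Rabs (u - t) < e / (Rabs B + 1)) in Hu.
apply Rlt_div_r in Hu; [|easy].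
eapply Rle_lt_trans; [apply H|].
pose proof (Rle_abs B); pose proof (Rabs_pos (u - t)); nra.
Qed.

(** While the Lipschitz constant of [N] stays below the smallest stretching
    [lam] of the linear part, [F] expands distances up to a factor, which gives
    injectivity and a Lipschitz inverse; and [F z = w] says that [z] is fixed by
    the contraction [z |-> lin_inv (w - N z)], which maps the disk of radius [r]
    to itself as soon as [|w| + |N z| <= lam r] there.  The preimage of the disk
    of radius [rho] is connected because the inverse carries each segment from
    [0] to a path. *)
Lemma linear_perturbation (F N : C -> C) al be r1 rho :
  let lam := Rabs (Cmod al - Cmod be) in
  Rabs (Cmod al ^ 2 - Cmod be ^ 2) = 1 -> 0 < r1 -> 0 < rho ->
  (forall z, disk r1 z -> continuous (F : C_UniformSpace -> C_UniformSpace) z) ->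
  (forall z, disk r1 z -> F z = (lin al be z + N z)%C) -> F (RtoC 0) = RtoC 0 ->
  (forall r, 0 <= r < r1 -> exists q, 0 <= q < 1 /\
     forall z w, Cmod z <= r -> Cmod w <= r ->
     Cmod (N z - N w) <= lam * q * Cmod (z - w)) ->
  (forall s, 0 <= s < rho -> exists r, 0 <= r < r1 /\
     forall z, Cmod z <= r -> s + Cmod (N z) <= lam * r) ->
  univalent_on (disk r1) F /\ contains_univalent_disk F r1 rho.
Proof.
intros lam HJ Hr1 Hrho Hcont HF F0 HN Hsize.
assert (Hlam : 0 < lam).
{ assert (E : lam * (Cmod al + Cmod be) = 1).
  { rewrite <- HJ; unfold lam.
    rewrite <- (Rabs_pos_eq (Cmod al + Cmod be)), <- Rabs_mult; [f_equal; ring|].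
    apply Rplus_le_le_0_compat; apply Cmod_ge_0. }
  assert (0 <= lam) by apply Rabs_pos.
  destruct (Req_dec lam 0) as [Z|]; [rewrite Z in E|]; lra. }
assert (Hexp : forall r, 0 <= r < r1 -> exists c, 0 < c /\
  forall z w, Cmod z <= r -> Cmod w <= r -> c * Cmod (z - w) <= Cmod (F z - F w)).
{ intros r Hr; destruct (HN r Hr) as [q [Hq HL]].
  exists (lam * (1 - q)); split; [apply Rmult_lt_0_compat; lra|].
  intros z w Hz Hw; rewrite !HF by (unfold disk; lra).
  assert (A := lin_lower al be (z - w)); fold lam in A.
  rewrite lin_minus in A.
  specialize (HL z w Hz Hw).
  assert (T := Cmod_triangle (lin al be z + N z - (lin al be w + N w)) (- (N z - N w))).
  rewrite Cmod_opp in T.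
  replace (lin al be z + N z - (lin al be w + N w) + - (N z - N w))%C
    with (lin al be z - lin al be w)%C in T by ring.
  lra. }
assert (Hinj : univalent_on (disk r1) F).
{ intros z w Hz Hw E; unfold disk in *.
  set (r := Rmax (Cmod z) (Cmod w)).
  assert (Hr : 0 <= r < r1).
  { split; [|now apply Rmax_lub_lt].
    eapply Rle_trans; [apply (Cmod_ge_0 z) | apply Rmax_l]. }
  destruct (Hexp r Hr) as [c [Hc HE]].
  specialize (HE z w (Rmax_l _ _) (Rmax_r _ _)).
  rewrite E in HE; replace (F w - F w)%C with (RtoC 0) in HE by ring.
  rewrite Cmod_0 in HE; pose proof (Cmod_ge_0 (z - w)).
  assert (D : (z - w)%C = RtoC 0) by (apply Cmod_eq_0; nra).
  replace z with ((z - w) + w)%C by ring; rewrite D; ring. }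
split; [exact Hinj|].
(* One closed disk in [disk r1] serves all values of modulus at most [s], which
   makes the inverse Lipschitz on them. *)
assert (Hsolve : forall s, 0 <= s < rho -> exists r, 0 <= r < r1 /\
  forall w, Cmod w <= s -> exists z, Cmod z <= r /\ F z = w).
{ intros s Hs; destruct (Hsize s Hs) as [r [Hr HS]].
  exists r; split; [easy|]; intros w Hw.
  destruct (HN r Hr) as [q [Hq HL]].
  assert (Hinv : forall u, lam * Cmod (lin_inv al be u) <= Cmod u).
  { intros u; rewrite <- (lin_lin_inv al be u HJ) at 2; apply lin_lower. }
  destruct (contraction_fixed_point (fun z => lin_inv al be (w - N z)) r q)
    as [z [Hz E]]; try easy.
  - intros z Hz; apply (Rmult_le_reg_l lam); [easy|].
    eapply Rle_trans; [apply Hinv|].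
    eapply Rle_trans; [apply (Cmod_triangle w (- N z))|].
    rewrite Cmod_opp; specialize (HS z Hz); lra.
  - intros z z' Hz Hz'; apply (Rmult_le_reg_l lam); [easy|].
    replace (lin_inv al be (w - N z) - lin_inv al be (w - N z'))%C
      with (lin_inv al be (N z' - N z)).
    2: { unfold lin_inv; rewrite !Cmult_conj, !Cminus_conj; ring. }
    eapply Rle_trans; [apply Hinv|]; rewrite Cmod_sub_sym.
    rewrite <- Rmult_assoc; now apply HL.
  - exists z; split; [easy|].
    rewrite HF by (unfold disk; lra).
    rewrite <- E at 1; rewrite lin_lin_inv by easy; ring. }
assert (D0 : disk r1 (RtoC 0)) by (unfold disk; rewrite Cmod_0; easy).
exists (fun z => disk r1 z /\ disk rho (F z)); split; [|split; [|split]].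
- split; [|split].
  + intros z [Hz HFz]; apply filter_and; [now apply disk_open|].
    apply (Hcont z Hz (disk rho)); now apply disk_open.
  + exists (RtoC 0); split; [easy|]; unfold disk; rewrite F0, Cmod_0; easy.
  + intros A B HA HB Hcov Hdis.
    (* The segment from [0] to [F z1] lifts to a path from [0] to [z1]. *)
    assert (Hsep : forall A' B' : C_UniformSpace -> Prop, open A' -> open B' ->
      (forall z, disk r1 z /\ disk rho (F z) <-> A' z \/ B' z) ->
      (forall z, ~ (A' z /\ B' z)) -> A' (RtoC 0) -> forall z, ~ B' z).
    { clear A B HA HB Hcov Hdis; intros A B HA HB Hcov Hdis HA0 z1 HB1.
      destruct (proj2 (Hcov z1) (or_intror HB1)) as [Hz1 HFz1]; unfold disk in HFz1.
      destruct (Hsolve (Cmod (F z1)) (conj (Cmod_ge_0 _) HFz1)) as [r [Hr HS]].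
      assert (Hc : forall t, Cmod (RtoC (clamp t) * F z1) <= Cmod (F z1)).
      { intros t; rewrite Cmod_mult, Cmod_R, Rabs_pos_eq by apply clamp_range.
        pose proof (clamp_range t); pose proof (Cmod_ge_0 (F z1)); nra. }
      set (ga := fun t => proj1_sig (constructive_indefinite_description _ (HS _ (Hc t)))).
      assert (Hga : forall t, Cmod (ga t) <= r /\ F (ga t) = (RtoC (clamp t) * F z1)%C)
        by (intros t; apply (proj2_sig (constructive_indefinite_description _ (HS _ (Hc t))))).
      assert (Hgd : forall t, disk r1 (ga t)).
      { intros t; unfold disk; destruct (Hga t); lra. }
      destruct (Hexp r Hr) as [c [Hc0 HE]].
      apply (no_path_between_separated_sets A B ga HA HB); auto.
      - apply (lipschitz_path_continuous ga (Cmod (F z1) / c)); intros t u.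
        destruct (Hga t) as [Ht Et], (Hga u) as [Hu Eu].
        specialize (HE _ _ Ht Hu); rewrite Et, Eu in HE.
        replace (RtoC (clamp t) * F z1 - RtoC (clamp u) * F z1)%C
          with (RtoC (clamp t - clamp u) * F z1)%C in HE
          by (rewrite RtoC_minus; ring).
        rewrite Cmod_mult, Cmod_R in HE.
        replace (Cmod (F z1) / c * Rabs (t - u)) with (Rabs (t - u) * Cmod (F z1) / c)
          by (field; lra).
        apply Rle_div_r; [easy|]; rewrite Rmult_comm.
        eapply Rle_trans; [exact HE|].
        apply Rmult_le_compat_r; [apply Cmod_ge_0 | apply clamp_lipschitz].
      - intros t; apply Hcov; split; [apply Hgd|].
        unfold disk; destruct (Hga t) as [_ ->]; eapply Rle_lt_trans; [apply Hc | easy].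
      - assert (E : @eq C (RtoC 0) (ga 0)); [|now rewrite <- E].
        apply Hinj; auto; rewrite F0; destruct (Hga 0) as [_ ->].
        replace (clamp 0) with 0; [ring|].
        unfold clamp, Rmax, Rmin; repeat destruct (Rle_dec _ _); lra.
      - assert (E : @eq C z1 (ga 1)); [|now rewrite <- E].
        apply Hinj; auto; destruct (Hga 1) as [_ ->].
        replace (clamp 1) with 1; [ring|].
        unfold clamp, Rmax, Rmin; repeat destruct (Rle_dec _ _); lra. }
    destruct (proj1 (Hcov (RtoC 0))) as [H0|H0].
    * split; [easy|]; unfold disk; rewrite F0, Cmod_0; easy.
    * right; now apply (Hsep A B).
    * left; apply (Hsep B A); auto.
      -- intros z; rewrite Hcov; tauto.
      -- intros z [? ?]; now apply (Hdis z).
- now intros z [Hz _].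
- intros z w [Hz _] [Hw _]; now apply Hinj.
- intros w; split.
  + intros Hw; destruct (Hsolve (Cmod w) (conj (Cmod_ge_0 w) Hw)) as [r [Hr HS]].
    destruct (HS w (Rle_refl _)) as [z [Hz E]]; exists z.
    rewrite E; repeat split; try easy; unfold disk; lra.
  + now intros [z [[_ Hz] <-]].
Qed.

(** * The radii of injectivity and covering *)

Lemma lip_sum_0 r : lip_sum 0 r = (2 * r - r ^ 2) / (1 - r) ^ 2.
Proof. unfold lip_sum; rewrite !sum1_0; ring. Qed.

Lemma lip_sum_S q r : lip_sum (S q) r =
  lip_sum q r + (r ^ (2 * S q) / (1 - r) ^ 2 + 2 * (INR (S q) * r ^ (2 * S q) / (1 - r))).
Proof. unfold lip_sum; rewrite !sum1_S; ring. Qed.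

Lemma size_sum_0 r : size_sum 0 r = r * (r / (1 - r)).
Proof. unfold size_sum; rewrite sum1_0; ring. Qed.

Lemma size_sum_S q r : size_sum (S q) r = size_sum q r + r * (r ^ (2 * S q) / (1 - r)).
Proof. unfold size_sum; rewrite !sum1_S; ring. Qed.

Lemma lip_sum_at_0 q : lip_sum q 0 = 0.
Proof.
induction q as [|q IH]; [rewrite lip_sum_0; field|].
rewrite lip_sum_S, IH, pow_i by lia; field.
Qed.

Lemma lip_sum_increasing q r s : 0 <= r -> r < s -> s < 1 -> lip_sum q r < lip_sum q s.
Proof.
intros Hr Hs H1.
assert (I1 : / (1 - r) < / (1 - s)) by (apply Rinv_lt_contravar; nra).
assert (I0 : 0 < / (1 - r)) by (apply Rinv_0_lt_compat; lra).
induction q as [|q IH].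
- rewrite !lip_sum_0.
  replace ((2 * r - r ^ 2) / (1 - r) ^ 2) with ((/ (1 - r)) ^ 2 - 1) by (field; lra).
  replace ((2 * s - s ^ 2) / (1 - s) ^ 2) with ((/ (1 - s)) ^ 2 - 1) by (field; lra).
  nra.
- rewrite !lip_sum_S; apply Rplus_lt_le_compat; [easy|].
  assert (P : 0 <= r ^ (2 * S q) <= s ^ (2 * S q)).
  { split; [apply pow_le; lra | apply pow_incr; lra]. }
  assert (I2 : / (1 - r) ^ 2 <= / (1 - s) ^ 2) by (apply Rinv_le_contravar; nra).
  assert (I3 : 0 < / (1 - r) ^ 2) by (apply Rinv_0_lt_compat; nra).
  pose proof (pos_INR (S q)).
  unfold Rdiv; apply Rplus_le_compat.
  + apply Rmult_le_compat; lra.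
  + apply Rmult_le_compat_l; [lra|]; apply Rmult_le_compat; try lra.
    * apply Rmult_le_pos; lra.
    * apply Rmult_le_compat_l; lra.
Qed.

Lemma lip_sum_lower q r : 0 <= r < 1 ->
  (2 * r - r ^ 2) / (1 - r) ^ 2 <= lip_sum q r.
Proof.
intros Hr; induction q as [|q IH]; [rewrite lip_sum_0; lra|].
rewrite lip_sum_S.
assert (0 <= r ^ (2 * S q)) by (apply pow_le; lra).
pose proof (pos_INR (S q)).
assert (0 <= r ^ (2 * S q) / (1 - r) ^ 2) by (apply Rdiv_le_0_compat; nra).
assert (0 <= INR (S q) * r ^ (2 * S q) / (1 - r)).
{ apply Rdiv_le_0_compat; [apply Rmult_le_pos|]; lra. }
lra.
Qed.

Lemma lip_sum_continuous q r : r < 1 -> continuous (lip_sum q) r.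
Proof.
intros Hr; induction q as [|q IH].
- apply (continuous_ext (fun r => (2 * r - r ^ 2) / (1 - r) ^ 2)).
  { intros x; now rewrite lip_sum_0. }
  apply (ex_derive_continuous (K := R_AbsRing) (V := R_NormedModule)).
  auto_derive; nra.
- apply (continuous_ext (fun r => lip_sum q r
    + (r ^ (2 * S q) / (1 - r) ^ 2 + 2 * (INR (S q) * r ^ (2 * S q) / (1 - r))))).
  { intros x; now rewrite lip_sum_S. }
  apply (continuous_plus (V := R_NormedModule)); [exact IH|].
  apply (ex_derive_continuous (K := R_AbsRing) (V := R_NormedModule)).
  auto_derive; repeat split; nra.
Qed.

Lemma size_sum_continuous q r : r < 1 -> continuous (size_sum q) r.
Proof.
intros Hr; induction q as [|q IH].
- apply (continuous_ext (fun r => r * (r / (1 - r)))).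
  { intros x; now rewrite size_sum_0. }
  apply (ex_derive_continuous (K := R_AbsRing) (V := R_NormedModule)).
  auto_derive; lra.
- apply (continuous_ext (fun r => size_sum q r + r * (r ^ (2 * S q) / (1 - r)))).
  { intros x; now rewrite size_sum_S. }
  apply (continuous_plus (V := R_NormedModule)); [exact IH|].
  apply (ex_derive_continuous (K := R_AbsRing) (V := R_NormedModule)).
  auto_derive; lra.
Qed.

Lemma radius_fun_eq M q r : radius_fun M (S q) r = 1 - sqrt (M ^ 4 - 1) * lip_sum q r.
Proof. unfold radius_fun, lip_sum; now replace (S q - 1)%nat with q by lia. Qed.

Lemma sqrt_M4_pos M : 1 < M -> 0 < sqrt (M ^ 4 - 1).
Proof.
intros HM; apply sqrt_lt_R0.
pose proof (Rlt_pow_R1 M 4 HM ltac:(lia)); lra.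
Qed.

(** The bracket increases strictly on the unit interval, so a root in that
    interval, once found, precedes all others. *)
Lemma least_positive_root_exists M q : 1 < M ->
  exists r1, 0 < r1 < 1 /\ least_positive_root M (S q) r1.
Proof.
intros HM; assert (HK := sqrt_M4_pos M HM); set (K := sqrt (M ^ 4 - 1)) in *.
(* At [1 / (1 + K)] the first term of the bracket is [(2 + 1 / K) / K], which
   already exceeds [1 / K]. *)
set (b := 1 / (1 + K)).
assert (Hb : 0 < b < 1).
{ unfold b; split; [apply Rdiv_lt_0_compat; lra | apply Rlt_div_l; lra]. }
assert (Hend : 1 <= K * lip_sum q b).
{ apply Rle_trans with (K * ((2 * b - b ^ 2) / (1 - b) ^ 2)).
  2: { apply Rmult_le_compat_l; [lra | apply lip_sum_lower; lra]. }
  replace (K * ((2 * b - b ^ 2) / (1 - b) ^ 2)) with (2 + / K)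
    by (unfold b; field; lra).
  pose proof (Rinv_0_lt_compat K HK); lra. }
set (f := fun t => K * lip_sum q (b * clamp t) - 1).
assert (fc : continuity f).
{ intros t; apply continuity_pt_filterlim.
  apply (continuous_minus (V := R_NormedModule)); [|apply continuous_const].
  apply (continuous_scal_r (K := R_AbsRing) (V := R_NormedModule) K
    (fun t => lip_sum q (b * clamp t))).
  apply (continuous_comp (fun t => b * clamp t) (lip_sum q)).
  - apply (continuous_scal_r (K := R_AbsRing) (V := R_NormedModule) b clamp).
    apply filterlim_locally; intros eps.
    exists eps; intros u Hu.
    eapply Rle_lt_trans; [apply clamp_lipschitz | exact Hu].
  - apply lip_sum_continuous; pose proof (clamp_range t); nra. }
assert (clamp 0 = 0) by
  (unfold clamp, Rmax, Rmin; repeat destruct (Rle_dec _ _); lra).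
assert (clamp 1 = 1) by
  (unfold clamp, Rmax, Rmin; repeat destruct (Rle_dec _ _); lra).
assert (f0 : f 0 = -1).
{ unfold f; replace (clamp 0) with 0; rewrite Rmult_0_r, lip_sum_at_0; ring. }
assert (f1 : 0 <= f 1).
{ unfold f; replace (clamp 1) with 1; rewrite Rmult_1_r; lra. }
destruct (IVT_gen f 0 1 0 fc) as [t [Ht Hft]].
{ rewrite Rmin_left, Rmax_right by lra; lra. }
exists (b * clamp t); set (r1 := b * clamp t) in *.
assert (Hroot : K * lip_sum q r1 = 1) by (unfold f in Hft; fold r1 in Hft; lra).
assert (Hr1 : 0 < r1 < 1).
{ pose proof (clamp_range t).
  assert (0 <= r1) by (unfold r1; nra).
  split; [|unfold r1; nra].
  destruct (Req_dec r1 0) as [E|]; [|lra].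
  rewrite E, lip_sum_at_0 in Hroot; lra. }
split; [easy|]; split.
- split; [lra|]; split; [lra|]; rewrite radius_fun_eq; fold K; lra.
- intros s [Hs0 [_ Hs]]; rewrite radius_fun_eq in Hs; fold K in Hs.
  destruct (Rle_or_lt r1 s) as [|Hlt]; [easy|].
  pose proof (lip_sum_increasing q s r1 ltac:(lra) Hlt ltac:(lra)); nra.
Qed.

(** The bracket [G] in the formula for the covering radius compares term by
    term with both sums: [G < lip_sum], whose multiple by [sqrt (M^4 - 1)] is [1]
    at the root, and [size_sum <= r G]. *)
Lemma rho_fun_pos_le M q r : 1 < M -> 0 < r < 1 ->
  radius_fun M (S q) r = 0 ->
  0 < rho_fun M (S q) r /\
  forall lam, lambda0 M <= lam ->
    rho_fun M (S q) r <= lam * (r - sqrt (M ^ 4 - 1) * size_sum q r).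
Proof.
intros HM Hr Hroot; rewrite radius_fun_eq in Hroot.
assert (HK := sqrt_M4_pos M HM); set (K := sqrt (M ^ 4 - 1)) in *.
unfold rho_fun; fold K; replace (S q - 1)%nat with q by lia.
set (G := r / (1 - r) + sum_n_m (fun k : nat => 2 * r ^ (2 * k) / (1 - r)) 1 q).
assert (Hi : 0 < / (1 - r)) by (apply Rinv_0_lt_compat; lra).
assert (HG : G < lip_sum q r /\ size_sum q r <= r * G).
{ unfold G; clear Hroot G; induction q as [|q [IH1 IH2]].
  - rewrite lip_sum_0; unfold size_sum; rewrite !sum1_0; split; [|lra].
    replace ((2 * r - r ^ 2) / (1 - r) ^ 2) with (/ (1 - r) * / (1 - r) - 1) by (field; lra).
    replace (r / (1 - r) + 0) with (/ (1 - r) - 1) by (field; lra).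
    assert (1 < / (1 - r)).
    { rewrite <- Rinv_1; apply Rinv_lt_contravar; lra. }
    nra.
  - rewrite lip_sum_S, size_sum_S, !sum1_S.
    set (P := r ^ (2 * S q)); assert (HP : 0 < P) by (apply pow_lt; lra).
    assert (HPi : 0 < P / (1 - r)) by (apply Rdiv_lt_0_compat; lra).
    assert (0 < P / (1 - r) ^ 2) by (apply Rdiv_lt_0_compat; nra).
    assert (1 <= INR (S q)) by (rewrite S_INR; pose proof (pos_INR q); lra).
    replace (INR (S q) * P / (1 - r)) with (INR (S q) * (P / (1 - r))) by (field; lra).
    replace (2 * P / (1 - r)) with (2 * (P / (1 - r))) by (field; lra).
    split; nra. }
replace (lambda0 M * r * (1 - K * (r / (1 - r))
   - K * sum_n_m (fun k : nat => 2 * r ^ (2 * k) / (1 - r)) 1 q))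
  with (lambda0 M * (r * (1 - K * G))) by (unfold G; ring).
destruct HG as [HG1 HG2].
assert (H1 : 0 < 1 - K * G) by nra.
assert (Hl0 : 0 < lambda0 M).
{ unfold lambda0; apply Rdiv_lt_0_compat; [apply sqrt_lt_R0; lra|].
  pose proof (sqrt_pos (M ^ 2 - 1)); assert (0 < sqrt (M ^ 2 + 1)) by (apply sqrt_lt_R0; nra).
  lra. }
assert (Hm : 0 < r * (1 - K * G)) by (apply Rmult_lt_0_compat; lra).
split; [now apply Rmult_lt_0_compat|].
intros lam Hlam; apply Rmult_le_compat; nra.
Qed.

(** * Polyharmonic mappings of the disk *)

Lemma polyharm_0 q al be h g :
  (forall j, (j <= q)%nat -> has_series (al j) (be j) (h j) (g j)) ->
  polyharm q h g (RtoC 0) = RtoC 0.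
Proof.
intros Hs; apply Cmod_eq_0, Rle_antisym; [|apply Cmod_ge_0].
eapply Rle_trans; [apply Cmod_csum_le|].
apply Rle_trans with (rsum (fun _ => 0) q); [|rewrite rsum_const; lra].
apply rsum_le; intros j Hj; rewrite Cmod_mult.
assert (E : Cmod (harm (h j) (g j) (RtoC 0)) <= 0).
{ assert (Hd : disk 1 (RtoC 0)) by (unfold disk; rewrite Cmod_0; lra).
  apply (Cmod_cseries_abs _ _ _ (harm_cseries _ _ _ _ _ (Hs j Hj) Hd)).
  intros n; apply Rle_trans with (rsum (fun _ => 0) n); [|rewrite rsum_const; lra].
  apply rsum_le; intros k _; eapply Rle_trans; [apply Cmod_trig_term_le|].
  rewrite Cmod_0, pow_i by lia; lra. }
pose proof (Cmod_ge_0 (harm (h j) (g j) (RtoC 0))).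
replace (Cmod (harm (h j) (g j) (RtoC 0))) with 0 by lra; lra.
Qed.

(** Bessel's inequality is exploited twice: the crude bound [2 M] for the
    coefficients makes the remainder quadratically small, which identifies the
    Jacobian; knowing it, the same inequality becomes sharp. *)
Lemma coefficient_estimates q al be h g F M :
  (forall j, (j <= q)%nat -> has_series (al j) (be j) (h j) (g j)) ->
  (forall n i j, (i <= q)%nat -> (j <= q)%nat ->
     0 <= Re (al i (S n) * Cconj (al j (S n)))%C) ->
  (forall n i j, (i <= q)%nat -> (j <= q)%nat ->
     0 <= Re (be i (S n) * Cconj (be j (S n)))%C) ->
  (forall z, disk 1 z -> F z = polyharm q h g z) ->
  1 <= M -> (forall z, disk 1 z -> Cmod (F z) <= M) ->
  Rabs (jacobian F (RtoC 0)) = 1 ->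
  Rabs (Cmod (al O 1%nat) ^ 2 - Cmod (be O 1%nat) ^ 2) = 1 /\
  Cmod (al O 1%nat) ^ 2 + Cmod (be O 1%nat) ^ 2 <= M ^ 2 /\
  forall n j, (j <= q)%nat -> (0 < n + j)%nat ->
    Cmod (al j (S n)) + Cmod (be j (S n))
    <= sqrt (M ^ 4 - 1) * Rabs (Cmod (al O 1%nat) - Cmod (be O 1%nat)).
Proof.
intros Hs Ha Hb HF HM HFM HJ.
assert (Hsq := fun n j => coefficient_square_bound q al be h g M n j Hs Ha Hb
  ltac:(intros z Hz; rewrite <- HF; auto)).
assert (H0 : Cmod (al O 1%nat) ^ 2 + Cmod (be O 1%nat) ^ 2 <= M ^ 2).
{ specialize (Hsq 1%nat O ltac:(lia) ltac:(lia)).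
  pose proof (pow2_ge_0 (Cmod (al O 2%nat))).
  pose proof (pow2_ge_0 (Cmod (be O 2%nat))); lra. }
assert (Hcrude : forall n j, (j <= q)%nat -> (0 < n + j)%nat ->
  Cmod (al j (S n)) + Cmod (be j (S n)) <= 2 * M).
{ intros n j Hj Hnj; specialize (Hsq n j Hj Hnj).
  pose proof (pow2_ge_0 (Cmod (al O 1%nat))); pose proof (pow2_ge_0 (Cmod (be O 1%nat))).
  pose proof (Cmod_ge_0 (al j (S n))); pose proof (Cmod_ge_0 (be j (S n))).
  assert (Cmod (al j (S n)) <= M) by nra.
  assert (Cmod (be j (S n)) <= M) by nra.
  lra. }
assert (HJ2 : jacobian F (RtoC 0) = Cmod (al O 1%nat) ^ 2 - Cmod (be O 1%nat) ^ 2).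
{ apply (jacobian_of_quadratic _ _ _ (2 * M * (2 * INR (S q)))); intros z Hz.
  rewrite HF, (polyharm_split q al be) by (unfold disk; lra).
  replace (lin (al O 1%nat) (be O 1%nat) z + remainder q al be h g z
    - lin (al O 1%nat) (be O 1%nat) z)%C with (remainder q al be h g z) by ring.
  eapply Rle_trans; [apply (remainder_bound q al be h g (2 * M) z (Cmod z)); auto; lra|].
  pose proof (size_sum_quadratic q (Cmod z) (conj (Cmod_ge_0 z) Hz)).
  rewrite (Rmult_assoc (2 * M)); apply Rmult_le_compat_l; lra. }
rewrite HJ2 in HJ; split; [easy|]; split; [easy|].
intros n j Hj Hnj; apply coefficient_pair_bound; auto using Cmod_ge_0.
Qed.

Lemma univalent_and_covers q al be h g F M :
  (forall j, (j <= q)%nat -> has_series (al j) (be j) (h j) (g j)) ->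
  (forall n i j, (i <= q)%nat -> (j <= q)%nat ->
     0 <= Re (al i (S n) * Cconj (al j (S n)))%C) ->
  (forall n i j, (i <= q)%nat -> (j <= q)%nat ->
     0 <= Re (be i (S n) * Cconj (be j (S n)))%C) ->
  (forall z, disk 1 z -> F z = polyharm q h g z) ->
  (forall z, disk 1 z -> continuous (F : C_UniformSpace -> C_UniformSpace) z) ->
  F (RtoC 0) = RtoC 0 -> Rabs (jacobian F (RtoC 0)) = 1 ->
  1 < M -> (forall z, disk 1 z -> Cmod (F z) <= M) ->
  exists r1, least_positive_root M (S q) r1 /\ univalent_on (disk r1) F /\
    contains_univalent_disk F r1 (rho_fun M (S q) r1).
Proof.
intros Hs Ha Hb HF Hcont F0 HJ HM HFM.
destruct (coefficient_estimates q al be h g F M Hs Ha Hb HF ltac:(lra) HFM HJ)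
  as [HJ2 [Hsq Hc]].
destruct (least_positive_root_exists M q HM) as [r1 [Hr1 Hroot]].
exists r1; split; [easy|]; destruct Hroot as [[_ [_ Hroot]] _].
destruct (rho_fun_pos_le M q r1 HM Hr1 Hroot) as [Hrho Hrhole].
rewrite radius_fun_eq in Hroot.
assert (HK := sqrt_M4_pos M HM); set (K := sqrt (M ^ 4 - 1)) in *.
set (lam := Rabs (Cmod (al O 1%nat) - Cmod (be O 1%nat))) in *.
assert (Hlam : lambda0 M <= lam) by (apply lambda0_le; auto using Cmod_ge_0; lra).
assert (Hlam0 : 0 <= lam) by apply Rabs_pos.
assert (HKl : 0 <= K * lam) by (apply Rmult_le_pos; lra).
apply (linear_perturbation F (remainder q al be h g) (al O 1%nat) (be O 1%nat)); auto.
- lra.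
- intros z Hz; apply Hcont; unfold disk in *; lra.
- intros z Hz; rewrite <- polyharm_split; apply HF; unfold disk in *; lra.
- intros r Hr; exists (K * lip_sum q r); split; [split|].
  + apply Rmult_le_pos; [lra|].
    rewrite <- (lip_sum_at_0 q); destruct (Req_dec r 0) as [->|]; [lra|].
    left; apply lip_sum_increasing; lra.
  + pose proof (lip_sum_increasing q r r1 ltac:(lra) ltac:(lra) ltac:(lra)); nra.
  + intros z w Hz Hw; fold lam.
    replace (lam * (K * lip_sum q r)) with (K * lam * lip_sum q r) by ring.
    apply remainder_lipschitz; auto; lra.
- intros s Hs'; fold lam.
  set (v := fun r => lam * (r - K * size_sum q r)).
  assert (Hv : s < v r1) by (specialize (Hrhole lam Hlam); unfold v; lra).
  assert (vc : continuous v r1).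
  { apply (continuous_scal_r (K := R_AbsRing) (V := R_NormedModule) lam
      (fun r => r - K * size_sum q r)).
    apply (continuous_minus (V := R_NormedModule)); [apply continuous_id|].
    apply (continuous_scal_r (K := R_AbsRing) (V := R_NormedModule) K (size_sum q)).
    apply size_sum_continuous; lra. }
  (* By continuity the strict inequality at [r1] persists slightly below it. *)
  destruct (vc (fun y => s < y) (open_gt s _ Hv)) as [e He].
  set (r := Rmax 0 (r1 - e / 2)); pose proof (cond_pos e).
  assert (Hr : 0 <= r < r1).
  { split; [apply Rmax_l | apply Rmax_lub_lt; lra]. }
  exists r; split; [easy|]; intros z Hz.
  assert (Hvr : s < v r).
  { apply He; change (Rabs (r - r1) < e).
    rewrite Rabs_left by lra; unfold r; pose proof (Rmax_r 0 (r1 - e / 2)); lra. }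
  assert (B := remainder_bound q al be h g (K * lam) z r Hs Hc HKl Hz ltac:(lra)).
  unfold v in Hvr; lra.
Qed.

(** The bound for the remaining coefficients is now zero, so [F] is its linear
    part; its two coefficients satisfy [x^2 + y^2 <= 1] and [|x^2 - y^2| = 1], so
    one vanishes, the other has modulus one, and [F] is an isometry. *)
Lemma extremal_case q al be h g F :
  (forall j, (j <= q)%nat -> has_series (al j) (be j) (h j) (g j)) ->
  (forall n i j, (i <= q)%nat -> (j <= q)%nat ->
     0 <= Re (al i (S n) * Cconj (al j (S n)))%C) ->
  (forall n i j, (i <= q)%nat -> (j <= q)%nat ->
     0 <= Re (be i (S n) * Cconj (be j (S n)))%C) ->
  (forall z, disk 1 z -> F z = polyharm q h g z) ->
  Rabs (jacobian F (RtoC 0)) = 1 -> (forall z, disk 1 z -> Cmod (F z) <= 1) ->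
  univalent_on (disk 1) F /\ maps_onto (disk 1) F (disk 1).
Proof.
intros Hs Ha Hb HF HJ HFM.
destruct (coefficient_estimates q al be h g F 1 Hs Ha Hb HF ltac:(lra) HFM HJ)
  as [HJ2 [Hsq Hc]].
replace (sqrt (1 ^ 4 - 1)) with 0 in Hc
  by (rewrite pow1, Rminus_diag, sqrt_0; easy).
set (al1 := al O 1%nat) in *; set (be1 := be O 1%nat) in *.
assert (HL : forall z, disk 1 z -> F z = lin al1 be1 z).
{ intros z Hz; rewrite HF, (polyharm_split q al be) by easy; fold al1 be1.
  assert (B := remainder_bound q al be h g _ z (Cmod z) Hs Hc ltac:(lra) (Rle_refl _) Hz).
  rewrite !Rmult_0_l in B; pose proof (Cmod_ge_0 (remainder q al be h g z)).
  rewrite (Cmod_eq_0 (remainder q al be h g z)) by lra; ring. }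
assert (Hiso : forall z, Cmod (lin al1 be1 z) = Cmod z).
{ intros z; rewrite pow1 in Hsq.
  assert (E : forall x y : C, Cmod x ^ 2 + Cmod y ^ 2 <= 1 ->
    Cmod x ^ 2 - Cmod y ^ 2 = 1 -> Cmod x = 1 /\ y = RtoC 0).
  { intros x y H1 H2; pose proof (Cmod_ge_0 x); pose proof (Cmod_ge_0 y).
    assert (Y : Cmod y = 0) by nra; split; [nra | now apply Cmod_eq_0]. }
  unfold Rabs in HJ2; destruct (Rcase_abs _).
  - destruct (E be1 al1) as [E1 E0]; [lra | lra|].
    unfold lin; rewrite E0, Cmult_0_l, Cplus_0_l, Cmod_conj, Cmod_mult, E1; ring.
  - destruct (E al1 be1) as [E1 E0]; [lra | lra|].
    unfold lin; rewrite E0, Cmult_0_l.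
    replace (al1 * z + Cconj (RtoC 0))%C with (al1 * z)%C
      by (apply injective_projections; simpl; ring).
    rewrite Cmod_mult, E1; ring. }
split.
- intros z w Hz Hw E; rewrite !HL in E by easy.
  assert (D : (z - w)%C = RtoC 0).
  { apply Cmod_eq_0; rewrite <- Hiso, lin_minus, E.
    replace (lin al1 be1 w - lin al1 be1 w)%C with (RtoC 0) by ring; apply Cmod_0. }
  replace z with ((z - w) + w)%C by ring; rewrite D; ring.
- intros w; split.
  + intros Hw; exists (lin_inv al1 be1 w).
    assert (Hd : disk 1 (lin_inv al1 be1 w)).
    { unfold disk in *; now rewrite <- Hiso, lin_lin_inv. }
    split; [easy|]; rewrite HL by easy; now apply lin_lin_inv.
  + intros [z [Hz <-]]; rewrite HL by easy; unfold disk in *; now rewrite Hiso.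
Qed.

Theorem theorem2 (p : nat) (F : C -> C) (a0 : C)
  (a b : nat -> nat -> C) (h g : nat -> C -> C)
  (p_ge1 : (1 <= p)%nat)
  (F_polyharmonic : polyharmonic p (disk 1) F)
  (hg_analytic : forall k : nat, (1 <= k <= p)%nat ->
     analytic_on (disk 1) (h k) /\ analytic_on (disk 1) (g k))
  (hg_series : forall (k : nat) (z : C), (1 <= k <= p)%nat -> disk 1 z ->
     power_series_from1 (fun n => a n k) (h k) z /\
     power_series_from1 (fun n => b n k) (g k) z)
  (F_form : forall z : C, disk 1 z ->
     F z = (a0 + sum_n_m (fun k : nat =>
        RtoC (Cmod z ^ (2 * (k - 1))) * (h k z + Cconj (g k z))) 1 p)%C)
  (arg_a : forall n k1 k2 : nat, (1 <= n)%nat ->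
     (1 <= k1 <= p)%nat -> (1 <= k2 <= p)%nat ->
     a n k1 <> RtoC 0 -> a n k2 <> RtoC 0 ->
     Rabs (Arg (a n k1 / a n k2)%C) <= PI / 2)
  (arg_b : forall n k3 k4 : nat, (1 <= n)%nat ->
     (1 <= k3 <= p)%nat -> (1 <= k4 <= p)%nat ->
     b n k3 <> RtoC 0 -> b n k4 <> RtoC 0 ->
     Rabs (Arg (b n k3 / b n k4)%C) <= PI / 2)
  (F_0 : F (RtoC 0) = RtoC 0)
  (J_0 : Rabs (jacobian F (RtoC 0)) - 1 = 0) :
  (forall M : R, 1 < M ->
     (forall z : C, disk 1 z -> Cmod (F z) <= M) ->
     exists r1 : R, least_positive_root M p r1 /\
       univalent_on (disk r1) F /\
       contains_univalent_disk F r1 (rho_fun M p r1))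
  /\
  ((forall z : C, disk 1 z -> Cmod (F z) <= 1) ->
     univalent_on (disk 1) F /\ maps_onto (disk 1) F (disk 1)).
Proof.
destruct p as [|q]; [lia|].
set (al := fun j n => a n (S j)); set (be := fun j n => b n (S j)).
set (h' := fun j => h (S j)); set (g' := fun j => g (S j)).
assert (Hs : forall j, (j <= q)%nat -> has_series (al j) (be j) (h' j) (g' j)).
{ intros j Hj z Hz; apply hg_series; [lia | easy]. }
assert (Ha : forall n i j, (i <= q)%nat -> (j <= q)%nat ->
  0 <= Re (al i (S n) * Cconj (al j (S n)))%C).
{ intros n i j Hi Hj; apply Re_mul_conj_nonneg_of_Arg, arg_a; lia. }
assert (Hb : forall n i j, (i <= q)%nat -> (j <= q)%nat ->
  0 <= Re (be i (S n) * Cconj (be j (S n)))%C).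
{ intros n i j Hi Hj; apply Re_mul_conj_nonneg_of_Arg, arg_b; lia. }
assert (Hform : forall z, disk 1 z -> F z = (a0 + polyharm q h' g' z)%C).
{ intros z Hz; rewrite (F_form z Hz); f_equal.
  rewrite <- (sum_n_m_S (G := C_AbelianMonoid)).
  apply (sum_n_m_ext (G := C_AbelianMonoid)); intros j.
  now replace (S j - 1)%nat with j by lia. }
assert (Ha0 : a0 = RtoC 0).
{ rewrite <- F_0, Hform, (polyharm_0 q al be) by (easy || unfold disk; rewrite Cmod_0; lra).
  ring. }
assert (HF : forall z, disk 1 z -> F z = polyharm q h' g' z).
{ intros z Hz; rewrite (Hform z Hz), Ha0; ring. }
split.
- intros M HM HFM; apply (univalent_and_covers q al be h' g'); auto; [|lra].
  destruct F_polyharmonic as [HC _]; simpl in HC; apply HC.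
- apply (extremal_case q al be h' g'); auto; lra.
Qed.
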